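(* Suppose every $f_{i,j}$ is $L$-smooth, $f$ is $\mu$-strongly-convex-$\mu$-strongly-concave with $\mu>0$, $\mathcal X=\mathbb R^{d_x}$, $\mathcal Y=\mathbb R^{d_y}$, and $n\ge 2$. Let $\varepsilon>0$ and run MC-SVRE with $p=\frac1{2n}$, $\eta=\frac{1}{6\sqrt n L}$, $$K=\left\lceil\sqrt\chi\,\log\left(\max\left\{\sqrt{12mnc_2C},\sqrt{291}\right\}\right)\right\rceil,\qquad C=\frac{8L\eta(2\kappa+3L\eta)}{m},\qquad c_2=\frac3p,$$ $$T=\left\lceil 6(n+4\kappa\sqrt n)\log\left(\frac{6\|\bar z_0-\bar z^*\|^2+\varepsilon}{\varepsilon}\right)\right\rceil,\qquad K_0=\left\lceil\sqrt\chi\,\log\left(\frac{10\kappa}{3m\sqrt nL^2\varepsilon}\left\|\mathbf g(\mathbf z_0)-\tfrac1m\mathbf 1\mathbf 1^\top\mathbf g(\mathbf z_0)\right\|^2\right)\right\rceil .$$ Then $\mathbb E\|\bar z_T-\bar z^*\|^2\le\varepsilon$, and to obtain this the algorithm requires at most $\mathcal O\big((n+\kappa\sqrt n)\log(1/\varepsilon)\big)$ SFO calls on each agent in expectation and $\mathcal O\big((n+\kappa\sqrt n)\sqrt\chi\,\log(\kappa n)\log(1/\varepsilon)\big)$ communication rounds.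
   Context: Problem. $m,n,d_x,d_y\ge1$ are integers, $d=d_x+d_y$, $\mathcal X\subseteq\mathbb R^{d_x}$, $\mathcal Y\subseteq\mathbb R^{d_y}$, $\mathcal Z=\{[x;y]:x\in\mathcal X,y\in\mathcal Y\}\subseteq\mathbb R^d$. For agents $1\le i\le m$ and $1\le j\le n$, $f_{i,j}:\mathbb R^{d_x}\times\mathbb R^{d_y}\to\mathbb R$ is differentiable; $f_i=\frac1n\sum_{j=1}^nf_{i,j}$ and $f=\frac1m\sum_{i=1}^mf_i$. The problem is $\min_{x\in\mathcal X}\max_{y\in\mathcal Y}f(x,y)$; $z^*=[x^*;y^*]\in\mathcal Z$ is its saddle point: $f(x^*,y)\le f(x^*,y^* )\le f(x,y^* )$ for all $x\in\mathcal X,y\in\mathcal Y$. Terminology. $f_{i,j}$ is $L$-smooth ($L>0$) if $\|\nabla f_{i,j}(x,y)-\nabla f_{i,j}(x',y')\|^2\le L^2(\|x-x'\|^2+\|y-y'\|^2)$ for all $x,x',y,y'$. $f$ is convex-concave if $f(x',y)\ge f(x,y)+\langle\nabla_xf(x,y),x'-x\rangle$ and $f(x,y')\le f(x,y)+\langle\nabla_yf(x,y),y'-y\rangle$ for all $x,x',y,y'$. $f$ is $\mu$-strongly-convex-$\mu$-strongly-concave if $f(x,y)-\frac\mu2\|x\|^2+\frac\mu2\|y\|^2$ is convex-concave. $\kappa=L/\mu$. Notation. $g(z)=[\nabla_xf(x,y);-\nabla_yf(x,y)]$ for $z=[x;y]$, and $g_i,g_{i,j}$ are defined likewise from $f_i,f_{i,j}$.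 Bold letters are aggregate matrices in $\mathbb R^{m\times d}$; $\mathbf z(i)\in\mathbb R^d$ is the $i$-th row of $\mathbf z$ as a column vector; $\mathbf g(\mathbf z)=[g_1(\mathbf z(1)),\dots,g_m(\mathbf z(m))]^\top$. $\mathbf 1$ is the all-ones vector. A bar denotes the row mean, $\bar z=\frac1m\mathbf 1^\top\mathbf z\in\mathbb R^{1\times d}$ (likewise $\bar w,\bar s,\bar v$); $\bar z^*=(z^* )^\top$, $\bar g(\bar z)=g(\bar z^\top)^\top$. $\|\cdot\|$ is the Euclidean/Frobenius norm. $\mathcal P_{\mathcal Z}$ is Euclidean projection onto $\mathcal Z$ and $\mathcal P_{\boldsymbol{\mathcal Z}}$ applies it to each row of an aggregate matrix (both are the identity when $\mathcal Z=\mathbb R^d$). Communication. The gossip matrix $W\in\mathbb R^{m\times m}$ is symmetric, $W_{i,j}\ne0$ iff $i,j$ are connected in the network or $i=j$, $0\preceq W\preceq I$, $W\mathbf 1=\mathbf 1$, $\mathrm{null}(I-W)=\mathrm{span}(\mathbf 1)$. $\lambda_2(W)$ is its second largest eigenvalue and $\chi=1/(1-\lambda_2(W))$. $\mathrm{FastMix}(\mathbf z^{(0)},K)$ returns $\mathbf z^{(K)}$, where $\mathbf z^{(-1)}=\mathbf z^{(0)}$, $\mathbf z^{(k+1)}=(1+\eta_u)W\mathbf z^{(k)}-\eta_u\mathbf z^{(k-1)}$, $\eta_u=\frac{1-\sqrt{1-\lambda_2^2(W)}}{1+\sqrt{1-\lambda_2^2(W)}}$ (a nonpositive prescribed $K$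 means no iteration). As in the paper's preliminaries, the following quoted result (Liu and Morse 2011, Lemma 2) is taken as given: $\frac1m\mathbf 1^\top\mathbf z^{(K)}=\bar z^{(0)}$ and $\|\mathbf z^{(K)}-\mathbf 1\bar z^{(0)}\|\le(1-\sqrt{1-\lambda_2(W)})^K\|\mathbf z^{(0)}-\mathbf 1\bar z^{(0)}\|$. Put $\rho=(1-\sqrt{1-\lambda_2(W)})^K$. MC-SVRE (parameters $\eta,K,K_0,T$). $p=1/(2n)$, $\alpha=1-p$. Initialize $\mathbf w_0=\mathbf z_0=[z_0,\dots,z_0]^\top$ with $z_0\in\mathcal Z$, $\mathbf v_0=\mathbf g(\mathbf z_0)$, $\mathbf s_0=\mathrm{FastMix}(\mathbf g(\mathbf z_0),K_0)$. For $t=0,\dots,T-1$: $\mathbf z'_t=\alpha\mathbf z_t+(1-\alpha)\mathbf w_t$; $\mathbf z_{t+1/2}=\mathrm{FastMix}(\mathcal P_{\boldsymbol{\mathcal Z}}(\mathbf z'_t-\eta\mathbf s_t),K)$; each agent $i$ independently draws $j_i$ uniformly from $\{1,\dots,n\}$ and sets $\mathbf v_{t+1/2}(i)=g_i(\mathbf w_t(i))+g_{i,j_i}(\mathbf z_{t+1/2}(i))-g_{i,j_i}(\mathbf w_t(i))$; $\mathbf s_{t+1/2}=\mathrm{FastMix}(\mathbf s_t+\mathbf v_{t+1/2}-\mathbf v_t,K)$; $\mathbf z_{t+1}=\mathrm{FastMix}(\mathcal P_{\boldsymbol{\mathcal Z}}(\mathbf z'_t-\eta\mathbf s_{t+1/2}),K)$;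 with probability $p$ (independently) $\mathbf w_{t+1}=\mathbf z_{t+1}$, $\mathbf v_{t+1}=\mathbf g(\mathbf z_{t+1})$, and otherwise $\mathbf w_{t+1}=\mathbf w_t$, $\mathbf v_{t+1}=\mathbf v_t$; $\mathbf s_{t+1}=\mathrm{FastMix}(\mathbf s_t+\mathbf v_{t+1}-\mathbf v_t,K)$. Complexity. One SFO call on agent $i$ is one evaluation of some $g_{i,j}$ at a point; one communication round is one multiplication by $W$. In $\mathcal O(\cdot)$, problem data not displayed in the bound (initial distance, initial gradient dissimilarity, etc.) are treated as constants. *)

(* Defs.v *)
From HB Require Import structures.
From mathcomp Require Import all_boot all_order all_algebra.
From mathcomp Require Import all_classical all_reals all_analysis.

Set Implicit Arguments.
Unset Strict Implicit.
Unset Printing Implicit Defensive.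

Import Order.TTheory GRing.Theory Num.Theory.
Import numFieldNormedType.Exports.

Local Open Scope classical_set_scope.
Local Open Scope ring_scope.

(* Conventions.
   - A point of R^k is a row vector 'rV[R]_k, so z = [x; y] is [row_mx x y],
     the i-th agent's copy in an aggregate matrix A is [row i A], and no
     transpose is needed between z and the row mean of an aggregate matrix.
   - [`|A|] is the library's sup norm on matrices; every norm of the
     mathematical text is [norm] below.  Differentiability does not depend on
     this choice. *)

Section Euclidean.
Variable R : realType.

Definition dotv k (u v : 'rV[R]_k) : R := \sum_i u 0 i * v 0 i.

Definition norm k l (A : 'M[R]_(k, l)) : R :=
  Num.sqrt (\sum_i \sum_j A i j ^+ 2).

Definition row_mean k l (A : 'M[R]_(k, l)) : 'rV[R]_l :=
  k%:R^-1 *: (const_mx 1 *m A).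

Definition spread k l (u : 'rV[R]_l) : 'M[R]_(k, l) := \matrix_(i < k) u.

(* Euclidean projection: a closest point of Z (0 if there is none). *)
Definition proj k (Z : set 'rV[R]_k) (z : 'rV[R]_k) : 'rV[R]_k :=
  xget 0 [set u | Z u /\ forall v, Z v -> norm (z - u) <= norm (z - v)].

Definition proj_rows k l (Z : set 'rV[R]_l) (A : 'M[R]_(k, l)) : 'M[R]_(k, l) :=
  \matrix_(i < k) proj Z (row i A).

(* A nonpositive prescribed number of iterations means no iteration.  Since
   [ln x = 0] for [x <= 0], this also covers a prescription log 0. *)
Definition nat_ceil (x : R) : nat :=
  if Num.ceil x is Posz k then k else 0%N.

End Euclidean.

Section ConvexConcave.
Variables (R : realType) (dx dy : nat).
Implicit Types (phi : 'rV[R]_dx -> 'rV[R]_dy -> R).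

Definition grad k (h : 'rV[R]_k -> R) (x : 'rV[R]_k) : 'rV[R]_k :=
  \row_i 'D_(delta_mx 0 i) h x.

Definition grad_x phi x y : 'rV[R]_dx := grad (fun x' => phi x' y) x.
Definition grad_y phi x y : 'rV[R]_dy := grad (phi x) y.

Definition smooth_fun (L : R) phi : Prop :=
  forall x x' y y',
    norm (row_mx (grad_x phi x y) (grad_y phi x y)
          - row_mx (grad_x phi x' y') (grad_y phi x' y')) ^+ 2
    <= L ^+ 2 * (norm (x - x') ^+ 2 + norm (y - y') ^+ 2).

Definition convex_concave phi : Prop :=
  (forall x x' y, phi x' y >= phi x y + dotv (grad_x phi x y) (x' - x)) /\
  (forall x y y', phi x y' <= phi x y + dotv (grad_y phi x y) (y' - y)).

Definition strongly_convex_concave (mu : R) phi : Prop :=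
  convex_concave (fun x y =>
    phi x y - mu / 2 * norm x ^+ 2 + mu / 2 * norm y ^+ 2).

Definition product_set (X : set 'rV[R]_dx) (Y : set 'rV[R]_dy) :
    set 'rV[R]_(dx + dy) :=
  [set z | X (lsubmx z) /\ Y (rsubmx z)].

Definition saddle_point (X : set 'rV[R]_dx) (Y : set 'rV[R]_dy) phi
    (z : 'rV[R]_(dx + dy)) : Prop :=
  product_set X Y z /\
  forall x y, X x -> Y y ->
    phi (lsubmx z) y <= phi (lsubmx z) (rsubmx z) <= phi x (rsubmx z).

Definition gda_op phi (z : 'rV[R]_(dx + dy)) : 'rV[R]_(dx + dy) :=
  row_mx (grad_x phi (lsubmx z) (rsubmx z))
         (- grad_y phi (lsubmx z) (rsubmx z)).

End ConvexConcave.

Section Gossip.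
Variables (R : realType) (m : nat).

Definition psd (A : 'M[R]_m) : Prop :=
  forall u : 'rV[R]_m, 0 <= (u *m A *m u^T) 0 0.

Definition gossip_matrix (e : rel 'I_m) (W : 'M[R]_m) : Prop :=
  [/\ W^T = W,
      forall i j, (W i j != 0) = e i j || (i == j),
      psd W /\ psd (1%:M - W),
      W *m const_mx 1 = const_mx 1 :> 'cV[R]_m
    & forall u : 'cV[R]_m,
        (1%:M - W) *m u = 0 <-> exists a, u = a *: const_mx 1].

(* The spectrum with multiplicity in nonincreasing order; for m = 1 there is
   no second eigenvalue and the value is 0, i.e., chi = 1. *)
Definition spectrum (W : 'M[R]_m) : seq R :=
  xget [::] [set s | sorted >=%R s /\ char_poly W = \prod_(a <- s) ('X - a%:P)].

Definition lambda2 (W : 'M[R]_m) : R := (spectrum W)`_1.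

Definition chi (W : 'M[R]_m) : R := 1 / (1 - lambda2 W).

Definition eta_u (W : 'M[R]_m) : R :=
  (1 - Num.sqrt (1 - lambda2 W ^+ 2)) / (1 + Num.sqrt (1 - lambda2 W ^+ 2)).

(* The pair is (z^(k), z^(k-1)); each iteration multiplies by W once. *)
Definition FastMix l (W : 'M[R]_m) (z0 : 'M[R]_(m, l)) (K : nat) :
    'M[R]_(m, l) :=
  (iter K (fun q => ((1 + eta_u W) *: (W *m q.1) - eta_u W *: q.2, q.1))
        (z0, z0)).1.

(* The quoted contraction estimate for K rounds of FastMix. *)
Definition fastmix_estimate l (W : 'M[R]_m) (K : nat) : Prop :=
  forall z0 : 'M[R]_(m, l),
    row_mean (FastMix W z0 K) = row_mean z0 /\
    norm (FastMix W z0 K - spread m (row_mean z0))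
      <= (1 - Num.sqrt (1 - lambda2 W)) ^+ K
         * norm (z0 - spread m (row_mean z0)).

End Gossip.

Section MCSVRE.
Variables (R : realType) (m n dx dy : nat).
Notation d := (dx + dy)%N.
Variable f : 'I_m -> 'I_n -> 'rV[R]_dx -> 'rV[R]_dy -> R.

Definition local_fun (i : 'I_m) x y : R := n%:R^-1 * \sum_j f i j x y.
Definition global_fun x y : R := m%:R^-1 * \sum_i local_fun i x y.

Definition g_sample (i : 'I_m) (j : 'I_n) : 'rV[R]_d -> 'rV[R]_d :=
  gda_op (f i j).
Definition g_local (i : 'I_m) : 'rV[R]_d -> 'rV[R]_d := gda_op (local_fun i).
Definition g_agg (z : 'M[R]_(m, d)) : 'M[R]_(m, d) :=
  \matrix_(i < m) g_local i (row i z).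

Definition p_coin : R := 1 / (2 * n%:R).

(* The randomness of one iteration: the indices j_i and whether w is updated. *)
Definition draw : finType := ({ffun 'I_m -> 'I_n} * bool)%type.

Definition draw_prob (xi : draw) : R :=
  (\prod_(i < m) n%:R^-1) * (if xi.2 then p_coin else 1 - p_coin).

(* Expectation over T independent iterations. *)
Definition expect (T : nat) (Q : T.-tuple draw -> R) : R :=
  \sum_(omega : T.-tuple draw) (\prod_(xi <- omega) draw_prob xi) * Q omega.

(* The iterates, together with the number of SFO calls made so far by each
   agent and the number of communication rounds made so far. *)
Record state := State {
  st_z : 'M[R]_(m, d);
  st_w : 'M[R]_(m, d);
  st_v : 'M[R]_(m, d);
  st_s : 'M[R]_(m, d);
  st_sfo : 'I_m -> nat;
  st_rounds : nat }.

Variables (X : set 'rV[R]_dx) (Y : set 'rV[R]_dy) (W : 'M[R]_m).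
Variables (eta : R) (K K0 : nat).

(* Evaluating g_i takes n SFO calls. *)
Definition mcsvre_init (z0 : 'rV[R]_d) : state :=
  let z := spread m z0 in
  State z z (g_agg z) (FastMix W (g_agg z) K0) (fun=> n) K0.

(* SFO calls: the two evaluations of g_{i,j_i}, and the n calls for
   g_i(z_{t+1}(i)) when w is updated.  The vector g_i(w_t(i)) costs nothing: it
   was computed when w was last updated and is stored as row i of v_t. *)
Definition mcsvre_step (st : state) (xi : draw) : state :=
  let: State z w v s sfo rounds := st in
  let P := @proj_rows R m d (product_set X Y) in
  let alpha := 1 - p_coin in
  let z' := alpha *: z + (1 - alpha) *: w in
  let z_half := FastMix W (P (z' - eta *: s)) K in
  let v_half := \matrix_(i < m)
    (g_local i (row i w) + g_sample i (xi.1 i) (row i z_half)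
     - g_sample i (xi.1 i) (row i w)) in
  let s_half := FastMix W (s + v_half - v) K in
  let z_next := FastMix W (P (z' - eta *: s_half)) K in
  let w_next := if xi.2 then z_next else w in
  let v_next := if xi.2 then g_agg z_next else v in
  let s_next := FastMix W (s + v_next - v) K in
  State z_next w_next v_next s_next
    (fun i => (sfo i + 2 + (if xi.2 then n else 0))%N)
    (rounds + (K + K + K + K))%N.

Definition mcsvre (z0 : 'rV[R]_d) (T : nat) (omega : T.-tuple draw) : state :=
  foldl mcsvre_step (mcsvre_init z0) omega.

End MCSVRE.

(* Main.v *)
Require Import Defs.
From HB Require Import structures.
From mathcomp Require Import all_boot all_order all_algebra.
From mathcomp Require Import all_classical all_reals all_analysis.
From mathcomp Require Import ring lra.

Set Implicit Arguments.
Unset Strict Implicit.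
Unset Printing Implicit Defensive.

Import Order.TTheory GRing.Theory Num.Theory.
Import numFieldNormedType.Exports.

Local Open Scope classical_set_scope.
Local Open Scope ring_scope.

(** FastMix preserves row means and the projections are the identity, so that
    [row_mean s = row_mean v] throughout and the row means perform loopless
    variance-reduced extragradient steps without constraints, for which the
    usual one-step inequality is an identity
    ([extragradient_identity]): the squared distance to the saddle point drops
    by the squared lengths of the half steps and by the inner product of the
    gradient estimate with the displacement from the saddle point, and it grows
    by the squared noise of the estimate.

    The noise needs no averaging: every sample is [L]-smooth, so [eta ^+ 2]
    times the squared noise is at most [eta ^+ 2 * L ^+ 2 = p / 18] times the
    mean squared distance from the query points to the reference points, which
    the half steps pay for.  Only the
    inner product is averaged over the samples; the estimate being unbiased
    ([vr_estimate_unbiased]), it becomes the inner product with the mean of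
    the local operators at the agents' query points.  Up to a consensus error
    this is the operator of the global function at the mean query point, which
    is [mu]-strongly monotone about the saddle point
    ([gda_op_strongly_monotone]).

    What remains are the deviations of the rows from their means.  They enter
    all of these estimates, and are fed by the motion of the iterates, but each
    of them passes through a FastMix call, which shrinks it by the square of
    the mixing rate.  The prescribed [K] makes this square at most [1 / 291]
    and at most the reciprocal of a multiple of [kappa * n * sqrt n], so that
    all consensus errors together fit into the slack of the mean recursion
    ([consensus_budget]).  The sum of the weighted squared distances of the
    means of [z] and [w] to the saddle point and of the consensus errors is
    then a Lyapunov function that contracts in expectation by
    [1 - 1 / (6 * (n + 4 * kappa * sqrt n))] per iteration
    ([state_lyapunov_step]).  The prescribed [K0] makes its initial value at
    most a multiple of the squared initial distance plus [eps], and the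
    prescribed [T] then brings it below [eps].

    Turning a mixing rate into a number of rounds requires
    [0 <= lambda2 W < 1].  The value 1 is excluded because the eigenvalue 1 of
    [W], which has a one-dimensional eigenspace, is a simple root of the
    characteristic polynomial ([char_poly_gossip]).

    The costs follow by counting: an iteration takes [4 * K] rounds and on
    average [5 / 2] calls per agent.  Since [kappa >= 1], [chi >= 1],
    [ln (kappa * n) >= ln 2] and [ln (1 / eps) >= ln (1 / eps0)], all additive
    constants, including the roundings, are absorbed by the displayed
    factors. *)

(** * Squared Euclidean norms, row means and deviations *)

Section EuclideanFacts.
Variable R : realType.

Lemma sqnormE k l (A : 'M[R]_(k, l)) :
  norm A ^+ 2 = \sum_i \sum_j A i j ^+ 2.
Proof.
by rewrite sqr_sqrtr //; do 2! (apply: sumr_ge0 => ? _); exact: sqr_ge0.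
Qed.

Lemma norm_ge0 k l (A : 'M[R]_(k, l)) : 0 <= norm A.
Proof. exact: sqrtr_ge0. Qed.

Lemma sqnorm_rvE k (u : 'rV[R]_k) : norm u ^+ 2 = \sum_j u 0 j ^+ 2.
Proof. by rewrite sqnormE big_ord1. Qed.

Lemma sqnorm_dotv k (u : 'rV[R]_k) : norm u ^+ 2 = dotv u u.
Proof. by rewrite sqnorm_rvE; apply: eq_bigr => j _; rewrite expr2. Qed.

Lemma sqnorm_rows k l (A : 'M[R]_(k, l)) :
  norm A ^+ 2 = \sum_i norm (row i A) ^+ 2.
Proof.
rewrite sqnormE; apply: eq_bigr => i _; rewrite sqnorm_rvE.
by apply: eq_bigr => j _; rewrite mxE.
Qed.

Lemma sqnorm0 k l : norm (0 : 'M[R]_(k, l)) ^+ 2 = 0.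
Proof.
rewrite sqnormE big1 // => i _; rewrite big1 // => j _.
by rewrite mxE expr0n.
Qed.

Lemma norm_eq0 k l (A : 'M[R]_(k, l)) : norm A = 0 -> A = 0.
Proof.
move=> A0; have : norm A ^+ 2 = 0 by rewrite A0 expr0n.
rewrite sqnormE => /eqP.
rewrite psumr_eq0; last by move=> i _; apply: sumr_ge0 => ? _; exact: sqr_ge0.
move=> /allP h; apply/matrixP => i j; rewrite mxE.
have /= := h i (mem_index_enum i); rewrite psumr_eq0; last first.
  by move=> ? _; exact: sqr_ge0.
by move=> /allP /(_ j (mem_index_enum j)) /=; rewrite sqrf_eq0 => /eqP.
Qed.

Lemma sqnormZ k l a (A : 'M[R]_(k, l)) : norm (a *: A) ^+ 2 = a ^+ 2 * norm A ^+ 2.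
Proof.
rewrite !sqnormE mulr_sumr; apply: eq_bigr => i _.
by rewrite mulr_sumr; apply: eq_bigr => j _; rewrite mxE exprMn.
Qed.

Lemma sqnormN k l (A : 'M[R]_(k, l)) : norm (- A) ^+ 2 = norm A ^+ 2.
Proof. by rewrite -scaleN1r sqnormZ sqrrN expr1n mul1r. Qed.

Lemma sqnormD_le k l (A B : 'M[R]_(k, l)) :
  norm (A + B) ^+ 2 <= 2 * (norm A ^+ 2 + norm B ^+ 2).
Proof.
rewrite !sqnormE -big_split mulr_sumr; apply: ler_sum => i _ /=.
rewrite -big_split mulr_sumr; apply: ler_sum => j _ /=; rewrite mxE.
have := sqr_ge0 (A i j - B i j); nra.
Qed.

Lemma sqnormB_le k l (A B : 'M[R]_(k, l)) :
  norm (A - B) ^+ 2 <= 2 * (norm A ^+ 2 + norm B ^+ 2).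
Proof. by rewrite -(sqnormN B); exact: sqnormD_le. Qed.

Lemma sqnorm_convex k l a (A B : 'M[R]_(k, l)) : 0 <= a <= 1 ->
  norm (a *: A + (1 - a) *: B) ^+ 2
  <= a * norm A ^+ 2 + (1 - a) * norm B ^+ 2.
Proof.
move=> /andP[a0 a1].
rewrite !sqnormE !mulr_sumr -big_split; apply: ler_sum => i _ /=.
rewrite !mulr_sumr -big_split; apply: ler_sum => j _ /=; rewrite !mxE.
rewrite -subr_ge0.
have -> : a * A i j ^+ 2 + (1 - a) * B i j ^+ 2
          - (a * A i j + (1 - a) * B i j) ^+ 2
          = (a * (1 - a)) * (A i j - B i j) ^+ 2 by ring.
by rewrite mulr_ge0 ?sqr_ge0 // mulr_ge0 // subr_ge0.
Qed.

Lemma dotv_sumr k (I : finType) (u : 'rV[R]_k) (v : I -> 'rV[R]_k) :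
  dotv u (\sum_i v i) = \sum_i dotv u (v i).
Proof.
rewrite /dotv exchange_big; apply: eq_bigr => j _ /=.
by rewrite summxE mulr_sumr.
Qed.

Lemma dotvC k (u v : 'rV[R]_k) : dotv u v = dotv v u.
Proof. by apply: eq_bigr => j _; rewrite mulrC. Qed.

Lemma dotvDl k (u v w : 'rV[R]_k) : dotv (u + v) w = dotv u w + dotv v w.
Proof. by rewrite -big_split; apply: eq_bigr => j _; rewrite mxE mulrDl. Qed.

Lemma dotvZl k a (u w : 'rV[R]_k) : dotv (a *: u) w = a * dotv u w.
Proof. by rewrite mulr_sumr; apply: eq_bigr => j _; rewrite mxE mulrA. Qed.

Lemma dotvNl k (u w : 'rV[R]_k) : dotv (- u) w = - dotv u w.
Proof. by rewrite -scaleN1r dotvZl mulN1r. Qed.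

Lemma dotvBl k (u v w : 'rV[R]_k) : dotv (u - v) w = dotv u w - dotv v w.
Proof. by rewrite dotvDl dotvNl. Qed.

Lemma dotvDr k (u v w : 'rV[R]_k) : dotv w (u + v) = dotv w u + dotv w v.
Proof. by rewrite dotvC dotvDl !(dotvC _ w). Qed.

Lemma dotvZr k a (u w : 'rV[R]_k) : dotv w (a *: u) = a * dotv w u.
Proof. by rewrite dotvC dotvZl dotvC. Qed.

Lemma dotvNr k (u w : 'rV[R]_k) : dotv w (- u) = - dotv w u.
Proof. by rewrite dotvC dotvNl dotvC. Qed.

Lemma dotvBr k (u v w : 'rV[R]_k) : dotv w (u - v) = dotv w u - dotv w v.
Proof. by rewrite dotvDr dotvNr. Qed.

Lemma dotv_young k c (u v : 'rV[R]_k) : 0 < c ->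
  - (2 * dotv u v) <= c^-1 * norm u ^+ 2 + c * norm v ^+ 2.
Proof.
move=> c0; rewrite !sqnorm_rvE !mulr_sumr -big_split -sumrN /=.
apply: ler_sum => j _.
have : 0 <= c * (c^-1 * u 0 j + v 0 j) ^+ 2.
  by rewrite mulr_ge0 ?sqr_ge0 ?ltW.
have -> : c * (c^-1 * u 0 j + v 0 j) ^+ 2
  = c^-1 * u 0 j ^+ 2 + c * v 0 j ^+ 2 + 2 * (u 0 j * v 0 j).
  by field; rewrite gt_eqF.
lra.
Qed.

Lemma sqnorm_row_mx k l (u : 'rV[R]_k) (v : 'rV[R]_l) :
  norm (row_mx u v) ^+ 2 = norm u ^+ 2 + norm v ^+ 2.
Proof.
rewrite !sqnorm_rvE big_split_ord /=; congr (_ + _); apply: eq_bigr => i _.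
  by rewrite row_mxEl.
by rewrite row_mxEr.
Qed.

Lemma dotv_row_mx k l (u u' : 'rV[R]_k) (v v' : 'rV[R]_l) :
  dotv (row_mx u v) (row_mx u' v') = dotv u u' + dotv v v'.
Proof.
rewrite /dotv big_split_ord /=; congr (_ + _); apply: eq_bigr => i _.
  by rewrite !row_mxEl.
by rewrite !row_mxEr.
Qed.

Lemma row_meanE k l (A : 'M[R]_(k, l)) :
  row_mean A = k%:R^-1 *: \sum_i row i A.
Proof.
apply/rowP => j; rewrite !mxE summxE; congr (_ * _).
by apply: eq_bigr => i _; rewrite !mxE mul1r.
Qed.

Lemma row_meanD k l (A B : 'M[R]_(k, l)) :
  row_mean (A + B) = row_mean A + row_mean B.
Proof. by rewrite /row_mean mulmxDr scalerDr. Qed.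

Lemma row_meanZ k l a (A : 'M[R]_(k, l)) : row_mean (a *: A) = a *: row_mean A.
Proof. by rewrite /row_mean -scalemxAr scalerA mulrC -scalerA. Qed.

Lemma row_meanN k l (A : 'M[R]_(k, l)) : row_mean (- A) = - row_mean A.
Proof. by rewrite -scaleN1r row_meanZ scaleN1r. Qed.

Lemma row_meanB k l (A B : 'M[R]_(k, l)) :
  row_mean (A - B) = row_mean A - row_mean B.
Proof. by rewrite row_meanD row_meanN. Qed.

Lemma row_spread k l i (u : 'rV[R]_l) : row i (spread k u) = u.
Proof. by apply/rowP => j; rewrite !mxE. Qed.

Lemma row_mean_spread k l (u : 'rV[R]_l) : (0 < k)%N -> row_mean (spread k u) = u.
Proof.
move=> k0; rewrite row_meanE (eq_bigr (fun=> u)) => [|i _]; last exact: row_spread.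
by rewrite sumr_const card_ord -[u *+ k]scaler_nat scalerA mulVf ?scale1r // pnatr_eq0 -lt0n.
Qed.

Definition dev k l (A : 'M[R]_(k, l)) := A - spread k (row_mean A).

Lemma devD k l (A B : 'M[R]_(k, l)) : dev (A + B) = dev A + dev B.
Proof. by apply/matrixP => i j; rewrite /dev row_meanD !mxE; ring. Qed.

Lemma devZ k l a (A : 'M[R]_(k, l)) : dev (a *: A) = a *: dev A.
Proof. by apply/matrixP => i j; rewrite /dev row_meanZ !mxE; ring. Qed.

Lemma devN k l (A : 'M[R]_(k, l)) : dev (- A) = - dev A.
Proof. by rewrite -scaleN1r devZ scaleN1r. Qed.

Lemma devB k l (A B : 'M[R]_(k, l)) : dev (A - B) = dev A - dev B.
Proof. by rewrite devD devN. Qed.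

Lemma dev_spread k l (u : 'rV[R]_l) : (0 < k)%N -> dev (spread k u) = 0.
Proof. by move=> k0; rewrite /dev row_mean_spread // subrr. Qed.

(** The deviations from the row mean sum to zero, so the cross terms vanish. *)
Lemma sqnorm_mean_dev k l (A : 'M[R]_(k, l)) : (0 < k)%N ->
  norm A ^+ 2 = k%:R * norm (row_mean A) ^+ 2 + norm (dev A) ^+ 2.
Proof.
move=> k0; have k0' : k%:R != 0 :> R by rewrite pnatr_eq0 -lt0n.
have sE : \sum_i row i A = k%:R *: row_mean A.
  by rewrite row_meanE scalerA mulfV // scale1r.
rewrite (sqnorm_rows (dev A)).
have -> : \sum_i norm (row i (dev A)) ^+ 2 =
    \sum_i (norm (row i A) ^+ 2 + norm (row_mean A) ^+ 2
            - 2 * dotv (row_mean A) (row i A)).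
  apply: eq_bigr => i _; rewrite /dev raddfB /= row_spread !sqnorm_dotv.
  by rewrite !dotvBl !dotvBr (dotvC (row i A) (row_mean A)); ring.
have dE : \sum_i 2 * dotv (row_mean A) (row i A) = 2 * (k%:R * norm (row_mean A) ^+ 2).
  by rewrite -mulr_sumr -dotv_sumr sE dotvZr -sqnorm_dotv.
rewrite !big_split sumrN dE /=.
by rewrite sumr_const card_ord -[_ *+ k]mulr_natl -sqnorm_rows; ring.
Qed.

Lemma sqnorm_row_mean_le k l (A : 'M[R]_(k, l)) : (0 < k)%N ->
  k%:R * norm (row_mean A) ^+ 2 <= norm A ^+ 2.
Proof. by move=> k0; rewrite [leRHS]sqnorm_mean_dev // lerDl sqr_ge0. Qed.

(** Jensen's inequality, from the decomposition of the matrix whose rows are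
    the [u i]. *)
Lemma sqnorm_mean_le k n (u : 'I_n -> 'rV[R]_k) : (0 < n)%N ->
  norm (n%:R^-1 *: \sum_i u i) ^+ 2 <= n%:R^-1 * \sum_i norm (u i) ^+ 2.
Proof.
move=> n0; have n0' : 0 < n%:R :> R by rewrite ltr0n.
have := sqnorm_row_mean_le (\matrix_i u i) n0.
rewrite row_meanE [leRHS]sqnorm_rows.
under eq_bigr do rewrite rowK; under [X in _ <= X]eq_bigr do rewrite rowK.
by rewrite ler_pdivlMl.
Qed.

Lemma sqnorm_dev_le k l (A : 'M[R]_(k, l)) : norm (dev A) ^+ 2 <= norm A ^+ 2.
Proof.
case: k A => [|k] A; first by rewrite !sqnormE !big_ord0.
by rewrite [leRHS]sqnorm_mean_dev // lerDr mulr_ge0 ?sqr_ge0.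
Qed.

Lemma proj_setT k (z : 'rV[R]_k) : Defs.proj [set: _] z = z.
Proof.
have zz : norm (z - z) = 0 by apply/eqP; rewrite -sqrf_eq0 subrr sqnorm0.
apply: xget_unique => [|u [_ /(_ z Logic.I)]].
  by split=> // v _; rewrite zz norm_ge0.
rewrite zz => h; apply/esym/eqP; rewrite -subr_eq0; apply/eqP/norm_eq0/eqP.
by rewrite eq_le h norm_ge0.
Qed.

Lemma proj_rows_setT k l (A : 'M[R]_(k, l)) : proj_rows [set: _] A = A.
Proof. by apply/matrixP => i j; rewrite mxE proj_setT mxE. Qed.

End EuclideanFacts.

(** * Gradients of averages and of the quadratic regularizer *)

Section Gradients.
Variables (R : realType).

(** The operator [gda_op] only involves partial derivatives, one argument at a
    time. *)
Definition partially_derivable dx dy (phi : 'rV[R]_dx -> 'rV[R]_dy -> R) :=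
  (forall x y v, derivable (phi^~ y) x v) /\
  (forall x y v, derivable (phi x) y v).

Lemma differentiable_partially dx dy (phi : 'rV[R]_dx -> 'rV[R]_dy -> R) :
  (forall x y,
     differentiable (fun u : 'rV[R]_dx * 'rV[R]_dy => phi u.1 u.2) (x, y)) ->
  partially_derivable phi.
Proof.
move=> dphi; split=> x y v; apply: diff_derivable.
  have dp : differentiable (fun x' : 'rV[R]_dx => (x', y)) x.
    exact: differentiable_pair.
  exact: (differentiable_comp dp (dphi x y)).
have dp : differentiable (fun y' : 'rV[R]_dy => (x, y')) y.
  exact: differentiable_pair.
exact: (differentiable_comp dp (dphi x y)).
Qed.

Lemma is_derive_mean k n (h : 'I_n -> 'rV[R]_k -> R) c x v :
  (forall j, derivable (h j) x v) ->
  is_derive x v (fun x' => c * \sum_j h j x') (c * \sum_j 'D_v (h j) x).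
Proof.
move=> dh.
have -> : (fun x' => c * \sum_j h j x') = c \*: (\sum_j h j).
  by apply/funext => x'; rewrite /= fct_sumE.
by apply: is_deriveZ; apply: is_derive_sum => j; exact: derivableP.
Qed.

Lemma partially_derivable_mean dx dy n c
    (phi : 'I_n -> 'rV[R]_dx -> 'rV[R]_dy -> R) :
  (forall j, partially_derivable (phi j)) ->
  partially_derivable (fun x y => c * \sum_j phi j x y).
Proof.
move=> dphi; split=> x y v.
  by have [] := @is_derive_mean _ _ (fun j x' => phi j x' y) c x v
    (fun j => (dphi j).1 x y v).
by have [] := @is_derive_mean _ _ (fun j => phi j x) c y v
  (fun j => (dphi j).2 x y v).
Qed.

Lemma grad_mean k n c (h : 'I_n -> 'rV[R]_k -> R) x :
  (forall j v, derivable (h j) x v) ->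
  grad (fun x' => c * \sum_j h j x') x = c *: \sum_j grad (h j) x.
Proof.
move=> dh; apply/rowP => i; rewrite !mxE summxE.
have d := @is_derive_mean _ _ h c x (delta_mx 0 i) (fun j => dh j _).
by rewrite derive_val; congr (_ * _); apply: eq_bigr => j _; rewrite mxE.
Qed.

Lemma gda_op_mean dx dy n c
    (phi : 'I_n -> 'rV[R]_dx -> 'rV[R]_dy -> R) z :
  (forall j, partially_derivable (phi j)) ->
  gda_op (fun x y => c * \sum_j phi j x y) z = c *: \sum_j gda_op (phi j) z.
Proof.
move=> dphi; rewrite /gda_op /grad_x /grad_y.
rewrite (@grad_mean _ _ c (fun j x' => phi j x' (rsubmx z))); last first.
  by move=> j v; exact: (dphi j).1.
rewrite grad_mean; last by move=> j v; exact: (dphi j).2.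
apply/rowP => i; case: (splitP i) => k ik.
  have -> : i = lshift dy k by apply/val_inj.
  rewrite row_mxEl !mxE !summxE; congr (_ * _); apply: eq_bigr => j _.
  by rewrite row_mxEl.
have -> : i = rshift dx k by apply/val_inj.
rewrite row_mxEr !mxE !summxE -mulrN -sumrN; congr (_ * _).
by apply: eq_bigr => j _; rewrite row_mxEr [RHS]mxE.
Qed.

Lemma is_derive_coord k (x v : 'rV[R]_k) j :
  is_derive x v (fun x' : 'rV[R]_k => x' 0 j) (v 0 j).
Proof.
have @f : {linear 'rV[R]_k -> R}.
  by exists (fun N : 'M[R]_(_, _) => N 0 j); do 2![eexists];
     do ?[constructor]; rewrite ?mxE// => ? *; rewrite ?mxE//;
     move=> ?; rewrite !mxE.
have fc : continuous f by exact: coord_continuous.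
apply: DeriveDef; first exact/diff_derivable/differentiable_coord.
by rewrite (@deriveE _ _ _ f) ?diff_lin //; exact: linear_differentiable.
Qed.

Lemma is_derive_sqnorm k (x v : 'rV[R]_k) :
  is_derive x v (fun x' : 'rV[R]_k => norm x' ^+ 2) (2 * dotv x v).
Proof.
have -> : (fun x' : 'rV[R]_k => norm x' ^+ 2) =
    \sum_j (fun x' : 'rV[R]_k => x' 0 j) ^+ 2.
  apply/funext => x'; rewrite fct_sumE sqnorm_rvE.
  by apply: eq_bigr => j _; rewrite exprfctE.
have d j := @is_derive_coord k x v j.
apply: is_derive_eq.
by rewrite mulr_sumr; apply: eq_bigr => j _; rewrite /= expr1 mulrA.
Qed.

Lemma dotv_delta k (u : 'rV[R]_k) i : dotv u (delta_mx 0 i) = u 0 i.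
Proof.
rewrite /dotv (bigD1 i) //= big1 ?addr0 => [|j ji]; rewrite mxE eqxx /=.
  by rewrite eqxx mulr1.
by rewrite (negPf ji) mulr0.
Qed.

Lemma grad_add_sqnorm k (h : 'rV[R]_k -> R) c e x :
  (forall v, derivable h x v) ->
  grad (fun x' => h x' + c * norm x' ^+ 2 + e) x = grad h x + (2 * c) *: x.
Proof.
move=> dh; apply/rowP => i; rewrite !mxE; set v := delta_mx 0 i.
have d1 : is_derive x v h ('D_v h x) by exact: derivableP.
have d2 := is_derive_sqnorm x v.
have -> : (fun x' => h x' + c * norm x' ^+ 2 + e) =
    h + c \*: (fun x' : 'rV[R]_k => norm x' ^+ 2) + cst e by apply/funext.
rewrite derive_val addr0 dotv_delta; congr (_ + _).
by rewrite /GRing.scale /=; ring.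
Qed.

End Gradients.

(** * Strong monotonicity of the gradient operator at the saddle point *)

Lemma le_of_shrunk_le (R : realType) (a b : R) :
  (forall t, 0 < t < 1 -> (1 - t) * a <= b) -> a <= b.
Proof.
move=> h; apply/ler_addgt0Pr => e e0.
(* this [t] makes [t * a] at most [e] *)
pose t := e / (e + `|a| + 1).
have a0 := normr_ge0 a; have le_a := ler_norm a.
have D0 : 0 < e + `|a| + 1 by lra.
have tD : t * (e + `|a| + 1) = e by rewrite mulfVK // gt_eqF.
have t0 : 0 < t by rewrite divr_gt0.
have t1 : t < 1 by rewrite ltr_pdivrMr //; lra.
have := h t; rewrite t0 t1 => /(_ isT).
have : t * a <= t * `|a| by rewrite ler_wpM2l // ltW.
nra.
Qed.

(** The first-order inequalities at a point [w] of the segment from the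
    minimizer [xs] to [x], compared with [h xs <= h w], give the claim up to the
    factor [1 - t], where [t] locates [w]; letting [w] tend to [xs] replaces
    the computation of a gradient at the minimizer. *)
Lemma quadratic_growth (R : realType) k (mu : R) (h : 'rV[R]_k -> R)
    (gr : 'rV[R]_k -> 'rV[R]_k) xs x :
  (forall w w', h w + dotv (gr w) (w' - w) + mu / 2 * norm (w' - w) ^+ 2
                <= h w') ->
  (forall w, h xs <= h w) ->
  h xs + mu / 2 * norm (x - xs) ^+ 2 <= h x.
Proof.
move=> first_order xsmin; rewrite addrC -lerBrDr.
apply: le_of_shrunk_le => t /andP[t0 t1].
pose w := xs + t *: (x - xs).
have h1 := first_order w x; have h2 := first_order w xs; have h3 := xsmin w.
have e1 : x - w = (1 - t) *: (x - xs).
  by rewrite /w scalerBl scale1r opprD addrA.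
have e2 : xs - w = - t *: (x - xs).
  by rewrite /w opprD addrA subrr sub0r scaleNr.
move: h1 h2; rewrite e1 e2 !dotvZr !sqnormZ => h1 h2.
set g := dotv _ _ in h1 h2; set N := norm _ ^+ 2 in h1 h2 *.
have N0 : 0 <= N by exact: sqr_ge0.
suff : t * ((1 - t) * (mu / 2 * N)) <= t * (h x - h xs) by rewrite ler_pM2l.
have := ler_wpM2l (ltW t0) h1.
have t1' : 0 <= 1 - t by lra.
have := ler_wpM2l t1' h2; nra.
Qed.

Section Monotone.
Variables (R : realType) (dx dy : nat).
Variables (phi : 'rV[R]_dx -> 'rV[R]_dy -> R) (mu : R).
Hypothesis dphi : partially_derivable phi.
Hypothesis scc : strongly_convex_concave mu phi.

Lemma strong_convexity_x x x' y :
  phi x y + dotv (grad_x phi x y) (x' - x) + mu / 2 * norm (x' - x) ^+ 2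
  <= phi x' y.
Proof.
have := scc.1 x x' y; rewrite /grad_x.
have -> : grad (fun x0 => phi x0 y - mu / 2 * norm x0 ^+ 2 + mu / 2 * norm y ^+ 2) x
    = grad (phi^~ y) x - mu *: x.
  under eq_fun do rewrite -mulNr.
  rewrite grad_add_sqnorm; last by move=> v; exact: dphi.1.
  have -> : 2 * - (mu / 2) = - mu by field.
  by rewrite scaleNr.
rewrite !sqnorm_dotv !dotvBl !dotvBr !dotvZl (dotvC x' x); lra.
Qed.

Lemma strong_concavity_y x y y' :
  phi x y' <=
  phi x y + dotv (grad_y phi x y) (y' - y) - mu / 2 * norm (y' - y) ^+ 2.
Proof.
have := scc.2 x y y'; rewrite /grad_y.
have -> : grad (fun y0 => phi x y0 - mu / 2 * norm x ^+ 2 + mu / 2 * norm y0 ^+ 2) y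
    = grad (phi x) y + mu *: y.
  under eq_fun do rewrite addrAC.
  rewrite grad_add_sqnorm; last by move=> v; exact: dphi.2.
  by have -> : 2 * (mu / 2) = mu by field.
rewrite !sqnorm_dotv !dotvBl !dotvDl !dotvBr !dotvZl (dotvC y' y); lra.
Qed.

Lemma gda_op_strongly_monotone zs z : saddle_point setT setT phi zs ->
  mu * norm (z - zs) ^+ 2 <= dotv (gda_op phi z) (z - zs).
Proof.
move=> [_ sp]; set x := lsubmx z; set y := rsubmx z.
set xs := lsubmx zs; set ys := rsubmx zs.
have gx : phi xs ys + mu / 2 * norm (x - xs) ^+ 2 <= phi x ys.
  apply: (@quadratic_growth _ _ mu (phi^~ ys)) => [w w'|w].
    exact: strong_convexity_x.
  by have /andP[] := sp w ys Logic.I Logic.I.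
have gy : phi xs y + mu / 2 * norm (y - ys) ^+ 2 <= phi xs ys.
  have concave w w' : - phi xs w + dotv (- grad_y phi xs w) (w' - w)
      + mu / 2 * norm (w' - w) ^+ 2 <= - phi xs w'.
    by have := strong_concavity_y xs w w'; rewrite dotvNl; lra.
  have ymax w : - phi xs ys <= - phi xs w.
    by rewrite lerN2; have /andP[] := sp xs w Logic.I Logic.I.
  by have /= := quadratic_growth y concave ymax; lra.
have zE : z - zs = row_mx (x - xs) (y - ys).
  by rewrite -[in LHS](hsubmxK z) -[in LHS](hsubmxK zs) opp_row_mx add_row_mx.
rewrite zE sqnorm_row_mx /gda_op dotv_row_mx dotvNl.
have hx := strong_convexity_x x xs y; have hy := strong_concavity_y x y ys.
rewrite -(opprB x xs) sqnormN dotvNr in hx.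
rewrite -(opprB y ys) sqnormN dotvNr in hy.
rewrite -/x -/y; lra.
Qed.

End Monotone.

(** * Lipschitz bounds and the condition number *)

Section Lipschitz.
Variables (R : realType) (dx dy : nat).
Implicit Types phi : 'rV[R]_dx -> 'rV[R]_dy -> R.

Lemma gda_op_lipschitz L phi z z' : smooth_fun L phi ->
  norm (gda_op phi z - gda_op phi z') ^+ 2 <= L ^+ 2 * norm (z - z') ^+ 2.
Proof.
move=> sm.
have := sm (lsubmx z) (lsubmx z') (rsubmx z) (rsubmx z').
rewrite !opp_row_mx !add_row_mx !sqnorm_row_mx.
rewrite (_ : - grad_y _ _ _ - - _ = - (grad_y phi (lsubmx z) (rsubmx z)
   - grad_y phi (lsubmx z') (rsubmx z'))) ?sqnormN; last first.
  by rewrite opprB opprK addrC.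
congr (_ <= _ * _).
by rewrite -[in RHS](hsubmxK z) -[in RHS](hsubmxK z') opp_row_mx add_row_mx
  sqnorm_row_mx.
Qed.

Lemma sqnorm_mean_lipschitz L n (g : 'I_n -> 'rV[R]_dx -> 'rV[R]_dy) z z' :
  (0 < n)%N ->
  (forall j, norm (g j z - g j z') ^+ 2 <= L ^+ 2 * norm (z - z') ^+ 2) ->
  norm (n%:R^-1 *: \sum_j g j z - n%:R^-1 *: \sum_j g j z') ^+ 2
  <= L ^+ 2 * norm (z - z') ^+ 2.
Proof.
move=> n0 gL; rewrite -scalerBr -sumrB.
apply: (le_trans (sqnorm_mean_le _ n0)).
rewrite ler_pdivrMl ?ltr0n //; apply: (le_trans (ler_sum _ (fun j _ => gL j))).
by rewrite sumr_const card_ord mulr_natl.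
Qed.

End Lipschitz.

(** Two points along one coordinate of [x] have gradients at least [mu] and at
    most [L] times their distance apart. *)
Lemma mu_le_L (R : realType) dx dy (phi : 'rV[R]_dx -> 'rV[R]_dy -> R) L mu :
  (0 < dx)%N -> 0 < L -> 0 < mu -> partially_derivable phi ->
  strongly_convex_concave mu phi ->
  (forall z z', norm (gda_op phi z - gda_op phi z') ^+ 2
                <= L ^+ 2 * norm (z - z') ^+ 2) ->
  mu <= L.
Proof.
case: dx phi => // dx phi _ L0 mu0 dphi scc lip.
pose a : 'rV[R]_dx.+1 := delta_mx 0 0; pose y : 'rV[R]_dy := 0.
have h1 := strong_convexity_x dphi scc 0 a y.
have h2 := strong_convexity_x dphi scc a 0 y.
rewrite subr0 in h1; rewrite sub0r sqnormN dotvNr in h2.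
have na : norm a ^+ 2 = 1 by rewrite sqnorm_dotv dotv_delta mxE !eqxx.
have := lip (row_mx a y) (row_mx 0 y).
rewrite /gda_op !row_mxKl !row_mxKr !opp_row_mx !add_row_mx !sqnorm_row_mx.
rewrite subr0 subrr sqnorm0 na addr0 mulr1.
set ga := grad_x phi a y in h2 *; set g0 := grad_x phi 0 y in h1 *.
have hc := @dotv_young R _ mu (ga - g0) (- a) mu0.
rewrite dotvNr sqnormN na dotvBl in hc; rewrite na in h1 h2.
have := sqr_ge0 (norm (- grad_y phi a y + grad_y phi 0 y)).
rewrite opprK => gy0 hL.
have hg : norm (ga - g0) ^+ 2 <= L ^+ 2 by lra.
have hm : mu * (mu^-1 * norm (ga - g0) ^+ 2) = norm (ga - g0) ^+ 2.
  by rewrite mulrA mulfV ?mul1r // gt_eqF.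
have : mu * mu <= L ^+ 2.
  apply: le_trans hg; rewrite -hm ler_pM2l //; lra.
by rewrite -expr2 ler_pXn2r ?nnegrE // ltW.
Qed.

(** * The second eigenvalue of a gossip matrix *)

Section Spectrum.
Variable R : realType.

Lemma char_poly_trmx n (A : 'M[R]_n) : char_poly A^T = char_poly A.
Proof.
rewrite /char_poly -[RHS]det_tr; congr (\det _).
by apply/matrixP => i j; rewrite !mxE eq_sym.
Qed.

Lemma char_poly_eigenvector_col n (A : 'M[R]_n) a : root (char_poly A) a ->
  exists2 v : 'cV[R]_n, v != 0 & A *m v = a *: v.
Proof.
rewrite -char_poly_trmx -eigenvalue_root_char => /eigenvalueP[u uA u0].
exists u^T; first by rewrite trmx_eq0.
by rewrite -[A]trmxK -trmx_mul uA linearZ.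
Qed.

(** The eigenvalues are Rayleigh quotients. *)
Lemma psd_eigenvalue_itv n (W : 'M[R]_n) a :
  psd W -> psd (1%:M - W) -> root (char_poly W) a -> 0 <= a <= 1.
Proof.
move=> W0 W1 /char_poly_eigenvector_col[v v0 Wv].
have vv : (v^T *m v) 0 0 = norm v^T ^+ 2.
  by rewrite mxE sqnorm_rvE; apply: eq_bigr => j _; rewrite !mxE expr2.
have vv0 : 0 < norm v^T ^+ 2.
  rewrite lt0r sqr_ge0 andbT sqrf_eq0; apply/eqP => /norm_eq0/eqP.
  by rewrite trmx_eq0 (negPf v0).
have := W0 v^T; rewrite trmxK -mulmxA Wv -scalemxAr mxE vv pmulr_lge0 // => ->.
have := W1 v^T; rewrite trmxK -mulmxA mulmxBl mul1mx Wv.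
by rewrite -[X in X - _]scale1r -scalerBl -scalemxAr mxE vv pmulr_lge0 // subr_ge0.
Qed.

(** Moving the all-ones column into the basis splits off the factor
    ['X - 1]; an eigenvector of the remaining block for the eigenvalue 1 lifts
    to a second fixed vector of [W], because the columns of [1%:M - W] sum to
    zero by symmetry. *)
Lemma char_poly_gossip (k : nat) (e : rel 'I_k.+1) (W : 'M[R]_k.+1) :
  gossip_matrix e W ->
  exists2 q, char_poly W = ('X - 1%:P) * q & ~~ root q 1.
Proof.
rewrite -[k.+1]/(1 + k)%N in e W *.
move=> [Wsym _ _ W1 Wnull].
pose a := ulsubmx W; pose r := ursubmx W; pose c := dlsubmx W; pose D := drsubmx W.
pose one : 'cV[R]_k := const_mx 1.
have WE : W = block_mx a r c D by rewrite submxK.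
have oneE : const_mx 1 = col_mx 1%:M one :> 'cV[R]_(1 + k).
  rewrite -[LHS]vsubmxK; congr col_mx; apply/colP => i; rewrite !mxE //.
  by rewrite !ord1.
have := W1; rewrite [in X in X -> _]WE oneE mul_block_col => /eq_col_mx[e1 e2].
rewrite mulmx1 in e1; rewrite mulmx1 in e2.
pose P : 'M[R]_(1 + k) := block_mx 1%:M 0 one 1%:M.
pose W'' := D - one *m r.
pose B : 'M[R]_(1 + k) := block_mx 1%:M r 0 W''.
have WP : W *m P = P *m B.
  rewrite WE !mulmx_block !mulmx1 !mulmx0 !mul1mx !mul0mx !add0r !addr0 e1 e2.
  by rewrite /W'' [one *m r + _]addrC subrK.
have detP : \det P = 1 by rewrite det_lblock !det1 mulr1.
have cW : char_poly W = ('X - 1%:P) * char_poly W''.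
  have -> : char_poly W = char_poly B.
    have : (char_poly_mx W) *m map_mx polyC P = map_mx polyC P *m char_poly_mx B.
      rewrite /char_poly_mx mulmxBl mulmxBr -!map_mxM WP; congr (_ - _).
      by rewrite -scalar_mxC.
    move=> /(congr1 determinant); rewrite !det_mulmx det_map_mx detP.
    by rewrite mulr1 mul1r.
  rewrite /char_poly /char_poly_mx map_block_mx scalar_mx_block.
  rewrite opp_block_mx add_block_mx map_mx0 oppr0 addr0 det_ublock.
  by rewrite map_mx1 -rmorphB /= det_scalar expr1.
exists (char_poly W''); first exact: cW.
apply/negP => /char_poly_eigenvector_col[v v0].
rewrite scale1r mulmxBl -mulmxA => /eqP; rewrite subr_eq => /eqP Dv.
pose u : 'cV[R]_(1 + k) := col_mx 0 v.
pose s := (r *m v) 0 0.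
have rv : r *m v = s%:M by rewrite [LHS]mx11_scalar.
have Wu : (1%:M - W) *m u = - s *: const_mx 1.
  rewrite mulmxBl mul1mx WE mul_block_col !mulmx0 !add0r Dv rv.
  rewrite opp_col_mx add_col_mx oneE scale_col_mx sub0r opprD addrA subrr sub0r.
  by rewrite !scaleNr scalemx1 mul_mx_scalar.
have s0 : s = 0.
  have : (const_mx 1 : 'rV[R]_(1 + k)) *m ((1%:M - W) *m u) = 0.
    rewrite mulmxA mulmxBr mulmx1.
    have -> : (const_mx 1 : 'rV[R]_(1 + k)) *m W = const_mx 1.
      by rewrite -Wsym -[const_mx 1 in LHS]trmx_const -trmx_mul W1 trmx_const.
    by rewrite subrr mul0mx.
  rewrite Wu => /(congr1 (fun A : 'M[R]_1 => A 0 0)).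
  rewrite -scalemxAr !mxE (eq_bigr (fun=> 1)) => [|i _]; last by rewrite !mxE mulr1.
  rewrite sumr_const card_ord => /eqP; rewrite mulf_eq0 oppr_eq0 pnatr_eq0.
  by rewrite orbF => /eqP.
have : (1%:M - W) *m u = 0 by rewrite Wu s0 oppr0 scale0r.
move=> /Wnull[b ub].
have : b = 0.
  have := congr1 (fun A : 'cV[R]_(1 + k) => A (lshift k 0) 0) ub.
  by rewrite col_mxEu !mxE mulr1.
move=> b0; move: ub; rewrite b0 scale0r /u -[0 in RHS]vsubmxK => /eq_col_mx[_].
by rewrite linear0 => v00; rewrite v00 eqxx in v0.
Qed.

(** If the second entry of the spectrum were 1, so would be the first, and 1
    would be a double root of the characteristic polynomial.  If there is no
    second entry, the default value of [nth] is 0. *)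
Lemma lambda2_itv m (e : rel 'I_m) (W : 'M[R]_m) : (0 < m)%N ->
  gossip_matrix e W -> 0 <= lambda2 W < 1.
Proof.
case: m e W => // k e W _ gW; have [q cW q1] := char_poly_gossip gW.
case: gW => _ _ [W0 W1] _ _.
rewrite /lambda2 /spectrum; case: xgetP => [s _ [ss cs]|_]; last first.
  by rewrite nth_nil lexx ltr01.
case: s ss cs => [|a [|b s]] /= ss cs; rewrite ?lexx ?ltr01 //.
have rt x : x \in [:: a, b & s] -> 0 <= x <= 1.
  by move=> xs; apply: (psd_eigenvalue_itv W0 W1); rewrite cs root_prod_XsubC.
have /andP[b0 b1] : 0 <= b <= 1 by apply: rt; rewrite !inE eqxx orbT.
have /andP[a0 a1] : 0 <= a <= 1 by apply: rt; rewrite !inE eqxx.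
rewrite b0 lt_neqAle b1 andbT /=; apply/negP => /eqP bE.
have aE : a = 1.
  by apply/eqP; rewrite eq_le a1 -bE; case/andP: ss.
move: cs; rewrite aE bE cW !big_cons => /(mulfI _) qE.
by move: q1; rewrite qE ?polyXsubC_eq0 // rootM root_XsubC eqxx.
Qed.

Lemma chi_ge1 m (e : rel 'I_m) (W : 'M[R]_m) : (0 < m)%N ->
  gossip_matrix e W -> 1 <= chi W.
Proof.
move=> m0 /(lambda2_itv m0)/andP[l0 l1]; rewrite /chi ler_pdivlMr; lra.
Qed.

(** [1 - x <= expR (- x)] with [x = 1 / sqrt chi]. *)
Lemma mixing_rate_le m (e : rel 'I_m) (W : 'M[R]_m) (K : nat) (M : R) :
  (0 < m)%N -> gossip_matrix e W -> 0 < M ->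
  Num.sqrt (chi W) * ln M <= K%:R ->
  0 <= (1 - Num.sqrt (1 - lambda2 W)) ^+ K <= M^-1.
Proof.
move=> m0 gW M0; have /andP[l0 l1] := lambda2_itv m0 gW.
set x := Num.sqrt (1 - lambda2 W).
have x0 : 0 < x by rewrite sqrtr_gt0; lra.
have x1 : x <= 1 by rewrite -[leRHS]sqrtr1 ler_sqrt //; lra.
have -> : Num.sqrt (chi W) = x^-1 by rewrite /chi div1r sqrtrV //; lra.
rewrite ler_pdivrMl // => hK.
rewrite exprn_ge0 ?subr_ge0 //=.
apply: (@le_trans _ _ (expR (- x) ^+ K)).
  by rewrite lerXn2r ?nnegrE ?subr_ge0 ?expR_ge0 //; exact: expR_ge1Dx.
rewrite -expRM_natl -[leRHS]lnK ?posrE ?invr_gt0 // ler_expR lnV ?posrE //.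
by rewrite mulrN lerN2 mulrC.
Qed.

Lemma nat_ceil_ge (x : R) : x <= (nat_ceil x)%:R.
Proof.
rewrite /nat_ceil; have := ceil_ge x.
case: (Num.ceil x) => k h; first exact: h.
by apply: (le_trans h); rewrite NegzE mulrNz oppr_le0 ler0z.
Qed.

Lemma nat_ceil_le (x : R) : (nat_ceil x)%:R <= Num.max 0 x + 1.
Proof.
rewrite /nat_ceil; have := ceilB1_lt x.
case: (Num.ceil x) => k; last by rewrite addr_ge0 // le_max lexx.
rewrite intrD rmorphN1 -pmulrn ltrBlDr => /ltW h.
by apply: (le_trans h); rewrite lerD2r le_max lexx orbT.
Qed.

End Spectrum.

(** * One iteration: the Lyapunov inequality for fixed sample indices *)

Section OneStep.
Variable R : realType.

(** All that the convergence proof uses of [FastMix]. *)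
Definition mixes k l (q : R) (A B : 'M[R]_(k, l)) :=
  row_mean B = row_mean A /\ norm (dev B) ^+ 2 <= q * norm (dev A) ^+ 2.

Lemma fastmix_mixes m l (W : 'M[R]_m) K (A : 'M[R]_(m, l)) :
  0 <= (1 - Num.sqrt (1 - lambda2 W)) ^+ K -> fastmix_estimate l W K ->
  mixes (((1 - Num.sqrt (1 - lambda2 W)) ^+ K) ^+ 2) A (FastMix W A K).
Proof.
move=> rho0 /(_ A)[eqm le_dev]; split=> //.
rewrite {1}/dev eqm -exprMn lerXn2r ?nnegrE ?mulr_ge0 ?norm_ge0 //.
Qed.

(** In the absence of constraints both half steps are explicit, so the
    three-point inequalities of the projected method are equalities; their
    combination holds coordinate by coordinate. *)
Lemma extragradient_identity k (p eta : R) (z w v vh zs : 'rV[R]_k) :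
  let z' := (1 - p) *: z + p *: w in
  let zh := z' - eta *: v in
  norm (z' - eta *: vh - zs) ^+ 2 =
    (1 - p) * norm (z - zs) ^+ 2 + p * norm (w - zs) ^+ 2
    - (1 - p) * norm (zh - z) ^+ 2 - p * norm (zh - w) ^+ 2
    - 2 * eta * dotv vh (zh - zs) + eta ^+ 2 * norm (vh - v) ^+ 2.
Proof.
move=> z' zh; rewrite !sqnorm_rvE /dotv !mulr_sumr -!sumrN -!big_split /=.
by apply: eq_bigr => j _; rewrite /zh /z' !mxE; ring.
Qed.

(** The consensus errors feed on each other and on the drift [M], but every
    mixing multiplies them by [q]; a reference point that is not refreshed
    keeps its error, so that [Dw] decreases only through the factor [1 - p].
    The factor [p / 18] is [eta ^+ 2 * L ^+ 2], and [h] is the weight with which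
    the error at the query points perturbs the monotonicity inequality. *)
Lemma consensus_budget (p q h th M S Dz Dw Ds Dh Dsh Dz' Ds0 Ds1 : R) :
  0 < p <= 4^-1 -> 0 <= q <= 291^-1 -> 0 <= h -> q * h <= p / 100 ->
  0 <= th <= p / 3 ->
  0 <= M -> 0 <= S -> 0 <= Dz -> 0 <= Dw -> 0 <= Ds -> 0 <= Dh -> 0 <= Dsh ->
  0 <= Dz' -> 0 <= Ds0 -> 0 <= Ds1 ->
  S <= M + 2 * (Dh + Dw) ->
  Dh <= q * (2 * ((1 - p) * Dz + p * Dw + Ds)) ->
  Dsh <= q * (2 * (Ds + p / 18 * S)) ->
  Dz' <= q * (2 * ((1 - p) * Dz + p * Dw + Dsh)) ->
  Ds0 <= q * Ds ->
  Ds1 <= q * (2 * (Ds + p / 18 *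
                  (2 * (p / 18 * S + M) + 2 * (Dz' + Dw)))) ->
  (1 + p) * Dz' + (1 - p) * Dw + (p * Ds1 + (1 - p) * Ds0)
    + p / 18 * S + h * Dh
  <= (1 - th) * (Dz + Dw + Ds) + p / 6 * M.
Proof.
move=> /andP[p0 p4] /andP[q0 q1] h0 qh /andP[th0 th1].
move=> M0 S0 Dz0 Dw0 Ds0_ Dh0 Dsh0 Dz'0 Ds00 Ds10 hS hDh hDsh hDz' hDs0 hDs1.
have le_q x y : 0 <= x -> y <= q * x -> y <= 291^-1 * x.
  by move=> x0 /le_trans; apply; exact: ler_wpM2r.
have mulp x : 0 <= x -> 0 <= p * x <= 4^-1 * x.
  by move=> x0; rewrite (mulr_ge0 (ltW p0) x0) (ler_wpM2r x0 p4).
have pS : p * S <= p * M + 2 * (p * Dh + p * Dw).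
  by have := ler_wpM2l (ltW p0) hS; lra.
have /andP[pM0 pM1] := mulp _ M0; have /andP[pS0 pS1] := mulp _ S0.
have /andP[pDz0 pDz1] := mulp _ Dz0; have /andP[pDw0 pDw1] := mulp _ Dw0.
have /andP[pDh0 pDh1] := mulp _ Dh0; have /andP[pDz'0 pDz'1] := mulp _ Dz'0.
have /andP[pDs10 pDs11] := mulp _ Ds10; have /andP[pDs00 pDs01] := mulp _ Ds00.
have hhDh : h * Dh <= p / 100 * (2 * (Dz + p * Dw + Ds)).
  have := ler_wpM2l h0 hDh; rewrite (mulrCA h q) (mulrA q h) => /le_trans; apply.
  have x0 : 0 <= 2 * ((1 - p) * Dz + p * Dw + Ds) by lra.
  apply: (le_trans (ler_wpM2r x0 qh)).
  by rewrite ler_wpM2l //; lra.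
have hhDh' : h * Dh <= 200^-1 * (Dz + p * Dw + Ds).
  have x0 : 0 <= Dz + p * Dw + Ds by lra.
  have /andP[_] := mulp _ x0; lra.
have ppS : p * (p * S) <= 4^-1 * (p * S) by have /andP[] := mulp _ pS0.
have hDh1 : Dh <= 291^-1 * (2 * ((1 - p) * Dz + p * Dw + Ds)).
  by apply: le_q hDh; lra.
have hDsh1 : Dsh <= 291^-1 * (2 * (Ds + p / 18 * S)) by apply: le_q hDsh; lra.
have hDz'1 : Dz' <= 291^-1 * (2 * ((1 - p) * Dz + p * Dw + Dsh)).
  by apply: le_q hDz'; lra.
have hDs01 : Ds0 <= 291^-1 * Ds by apply: le_q hDs0.
have pps0 : 0 <= p * (p * S) by rewrite mulr_ge0 // ltW.
have hDs11 : Ds1 <= 291^-1 * (2 * (Ds + p / 18 *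
                  (2 * (p / 18 * S + M) + 2 * (Dz' + Dw)))).
  by apply: le_q hDs1; lra.
have th_z : th * Dz <= 12^-1 * Dz by rewrite ler_wpM2r //; lra.
have th_s : th * Ds <= 12^-1 * Ds by rewrite ler_wpM2r //; lra.
have th_w : th * Dw <= p / 3 * Dw by rewrite ler_wpM2r.
lra.
Qed.

End OneStep.
Lemma onem_itv (R : realType) (p : R) : 0 < p <= 4^-1 -> 0 <= 1 - p <= 1.
Proof. by move=> /andP[p0 p4]; lra. Qed.

(** Averaging over the refresh of the reference point.  In the Lyapunov
    function the mean of [z] has weight [1 - p] and that of [w] weight 1, so
    the new point gets the total weight [p * (2 - p) + (1 - p) ^+ 2 = 1], and the
    distance [Wd] of the old reference point, which is kept with probability
    [1 - p] and has weight [p] in [Zp], is exactly preserved. *)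
Lemma lyapunov_average (R : realType) (p Zp Z Wd A N G V im S Dz' Dw B1 B0 h E : R) :
  Zp = (1 - p) * Z + p * Wd - (1 - p) * A - p * N - G + V ->
  V <= im * (p / 18 * S) ->
  im * ((1 + p) * Dz' + (1 - p) * Dw + (p * B1 + (1 - p) * B0)
        + p / 18 * S + h) <= im * E ->
  p * ((1 - p) * Zp + Zp + im * (Dz' + Dz' + B1))
    + (1 - p) * ((1 - p) * Zp + Wd + im * (Dz' + Dw + B0))
  <= (1 - p) * Z + Wd - (1 - p) * A - p * N + im * (E - h) - G.
Proof. by move=> -> hV hE; lra. Qed.

Lemma perturbed_monotone_arith (R : realType) (mu eta im L N D a b : R) :
  0 <= eta -> mu * N <= b ->
  - (2 * (a - b)) <= mu^-1 * (im * (L ^+ 2 * D)) + mu * N ->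
  eta * mu * N - im * (eta * (L ^+ 2 / mu) * D) <= 2 * eta * a.
Proof.
move=> eta0 h1 h2.
have : 0 <= eta * (2 * a - mu * N + mu^-1 * (im * (L ^+ 2 * D))).
  by rewrite mulr_ge0 //; lra.
lra.
Qed.

Lemma lyapunov_contraction_arith (R : realType)
    (p th e im m Z Wd A N U C h G : R) :
  im * m = 1 -> 0 < p <= 4^-1 -> 0 <= th <= p / 3 -> 4 * th <= e ->
  0 <= A -> 0 <= N -> 0 <= U ->
  Z <= 2 * (U + A) -> Wd <= 2 * (U + N) -> e * U - im * h <= G ->
  (1 - p) * Z + Wd - (1 - p) * A - p * N
    + im * ((1 - th) * C + p / 6 * (m * N) - h) - G
  <= (1 - th) * ((1 - p) * Z + Wd + im * C).
Proof.
move=> mE /andP[p0 p4] /andP[th0 th3] th4 A0 N0 U0 hZ hW hG.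
have imN : im * (p / 6 * (m * N)) = p / 6 * N.
  by transitivity (im * m * (p / 6 * N)); [ring | rewrite mE mul1r].
have p1 : 0 <= th * (1 - p) by rewrite mulr_ge0 // subr_ge0; lra.
have := ler_wpM2l p1 hZ; have := ler_wpM2l th0 hW.
have : 0 <= (1 - 2 * th) * ((1 - p) * A) by rewrite !mulr_ge0 //; lra.
have : 0 <= (e - 4 * th) * U by rewrite mulr_ge0 // subr_ge0.
have : 0 <= (p / 3 - th) * N by rewrite mulr_ge0 // subr_ge0.
have : 0 <= p * N by rewrite mulr_ge0 // ltW.
have : 0 <= th * (p * U) by rewrite !mulr_ge0 // ltW.
move: imN hG {hZ hW th3 th4 p4 mE p1}; lra.
Qed.

Section LyapunovStep.
Variables (R : realType) (m d : nat) (p eta L mu q th : R).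
Hypotheses (m0 : (0 < m)%N) (p_itv : 0 < p <= 4^-1)
  (mu0 : 0 < mu) (eta0 : 0 < eta) (q_itv : 0 <= q <= 291^-1)
  (etaL : eta ^+ 2 * L ^+ 2 = p / 18)
  (qh : q * (eta * (L ^+ 2 / mu)) <= p / 100)
  (th_itv : 0 <= th <= p / 3) (th_mu : 4 * th <= eta * mu).

(** The tracking error is scaled by [eta ^+ 2] because [s] moves the iterates
    through [eta *: s] only. *)
Definition consensus_error (z w s : 'M[R]_(m, d)) :=
  norm (dev z) ^+ 2 + norm (dev w) ^+ 2 + eta ^+ 2 * norm (dev s) ^+ 2.

Definition lyapunov zs (z w s : 'M[R]_(m, d)) :=
  (1 - p) * norm (row_mean z - zs) ^+ 2 + norm (row_mean w - zs) ^+ 2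
  + m%:R^-1 * consensus_error z w s.

(** Averaged over the refresh only: [vh] is the gradient estimate for fixed
    sample indices, [s1] and [s0] are the tracking variables with and without
    refresh.  The right-hand side depends on the samples through the last term
    alone, and linearly. *)
Lemma lyapunov_step_fixed_samples (zs : 'rV[R]_d)
    (z w s v zh vh sh zp vp s1 s0 : 'M[R]_(m, d)) :
  let z' := (1 - p) *: z + p *: w in
  let M := m%:R * norm (row_mean zh - row_mean w) ^+ 2 in
  row_mean s = row_mean v ->
  mixes q (z' - eta *: s) zh ->
  mixes q (s + vh - v) sh ->
  mixes q (z' - eta *: sh) zp ->
  mixes q (s + vp - v) s1 ->
  mixes q (s + v - v) s0 ->
  norm (vh - v) ^+ 2 <= L ^+ 2 * norm (zh - w) ^+ 2 ->
  norm (vp - v) ^+ 2 <= L ^+ 2 * norm (zp - w) ^+ 2 ->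
  p * lyapunov zs zp zp s1 + (1 - p) * lyapunov zs zp w s0
  <= (1 - p) * norm (row_mean z - zs) ^+ 2 + norm (row_mean w - zs) ^+ 2
     - (1 - p) * norm (row_mean zh - row_mean z) ^+ 2
     - p * norm (row_mean zh - row_mean w) ^+ 2
     + m%:R^-1 * ((1 - th) * consensus_error z w s + p / 6 * M
                  - eta * (L ^+ 2 / mu) * norm (dev zh) ^+ 2)
     - 2 * eta * dotv (row_mean vh) (row_mean zh - zs).
Proof.
move=> z' M smean [zhm zhd] [shm shd] [zpm zpd] [s1m s1d] [s0m s0d] vhL vpL.
have m0' : 0 < m%:R :> R by rewrite ltr0n.
have /andP[p0 p4] := p_itv.
have p1 := onem_itv p_itv.
have eta2 : 0 < eta ^+ 2 by rewrite exprn_gt0.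
have shm' : row_mean sh = row_mean vh.
  by rewrite shm row_meanB row_meanD smean addrAC subrr add0r.
have z'm : row_mean z' = (1 - p) *: row_mean z + p *: row_mean w.
  by rewrite row_meanD !row_meanZ.
have zh_mean : row_mean zh = row_mean z' - eta *: row_mean v.
  by rewrite zhm row_meanB row_meanZ smean.
have zp_mean : row_mean zp = row_mean z' - eta *: row_mean vh.
  by rewrite zpm row_meanB row_meanZ shm'.
have := extragradient_identity p eta (row_mean z) (row_mean w) (row_mean v)
  (row_mean vh) zs.
rewrite /= -z'm -zh_mean -zp_mean => id_zp.
set N := norm (row_mean zh - row_mean w) ^+ 2 in M id_zp *.
set S := norm (zh - w) ^+ 2 in vhL.
have SE : S <= M + 2 * (norm (dev zh) ^+ 2 + norm (dev w) ^+ 2).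
  by rewrite /S sqnorm_mean_dev // row_meanB devB lerD2l sqnormB_le.
have dz' : norm (dev z') ^+ 2
    <= (1 - p) * norm (dev z) ^+ 2 + p * norm (dev w) ^+ 2.
  rewrite devD !devZ; have := @sqnorm_convex _ _ _ (1 - p) (dev z) (dev w).
  by rewrite subKr; apply.
have q0 : 0 <= q by case/andP: q_itv.
have dz'B (a : 'M[R]_(m, d)) : q * norm (dev (z' - eta *: a)) ^+ 2 <=
    q * (2 * ((1 - p) * norm (dev z) ^+ 2 + p * norm (dev w) ^+ 2
              + eta ^+ 2 * norm (dev a) ^+ 2)).
  apply: ler_wpM2l => //; rewrite devB; apply: (le_trans (sqnormB_le _ _)).
  by rewrite devZ sqnormZ ler_pM2l // lerD2r.
have sB (a : 'M[R]_(m, d)) (x : R) : norm (a - v) ^+ 2 <= L ^+ 2 * x ->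
    q * (eta ^+ 2 * norm (dev (s + a - v)) ^+ 2) <=
    q * (2 * (eta ^+ 2 * norm (dev s) ^+ 2 + p / 18 * x)).
  move=> ax; apply: ler_wpM2l => //.
  have dle : norm (dev (s + a - v)) ^+ 2
      <= 2 * (norm (dev s) ^+ 2 + norm (a - v) ^+ 2).
    rewrite -addrA devD; apply: (le_trans (sqnormD_le _ _)).
    by rewrite ler_pM2l // lerD2l sqnorm_dev_le.
  apply: (le_trans (ler_wpM2l (ltW eta2) dle)).
  rewrite mulrCA ler_pM2l // mulrDr lerD2l -etaL -mulrA.
  exact: (ler_wpM2l (ltW eta2) ax).
have vhN : m%:R * norm (row_mean vh - row_mean v) ^+ 2 <= L ^+ 2 * S.
  by rewrite -row_meanB; apply: le_trans vhL; exact: sqnorm_row_mean_le.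
have vhN' : m%:R * (eta ^+ 2 * norm (row_mean vh - row_mean v) ^+ 2)
    <= p / 18 * S.
  by rewrite mulrCA -etaL -mulrA ler_pM2l.
(* the displacement between the two extragradient points is [eta] times the
   displacement of the gradient estimates *)
have zp_zh : norm (row_mean zp - row_mean zh) ^+ 2 =
    eta ^+ 2 * norm (row_mean vh - row_mean v) ^+ 2.
  have -> : row_mean zp - row_mean zh = - (eta *: (row_mean vh - row_mean v)).
    by rewrite zp_mean zh_mean scalerBr !opprB addrC subrKA.
  by rewrite sqnormN sqnormZ.
have zp_w : norm (zp - w) ^+ 2 <=
    2 * (p / 18 * S + M) + 2 * (norm (dev zp) ^+ 2 + norm (dev w) ^+ 2).
  rewrite sqnorm_mean_dev // devB row_meanB.
  apply: lerD; last exact: sqnormB_le.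
  have -> : row_mean zp - row_mean w =
      (row_mean zp - row_mean zh) + (row_mean zh - row_mean w).
    by rewrite addrA subrK.
  apply: (le_trans (ler_wpM2l (ltW m0') (sqnormD_le _ _))).
  by rewrite mulrCA ler_pM2l // mulrDr -/N zp_zh lerD2r.
have budget := @consensus_budget R p q (eta * (L ^+ 2 / mu)) th M S
  (norm (dev z) ^+ 2) (norm (dev w) ^+ 2) (eta ^+ 2 * norm (dev s) ^+ 2)
  (norm (dev zh) ^+ 2) (eta ^+ 2 * norm (dev sh) ^+ 2) (norm (dev zp) ^+ 2)
  (eta ^+ 2 * norm (dev s0) ^+ 2) (eta ^+ 2 * norm (dev s1) ^+ 2)
  p_itv q_itv.
have h0 : 0 <= eta * (L ^+ 2 / mu).
  by rewrite mulr_ge0 ?divr_ge0 ?sqr_ge0 // ltW.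
have M0 : 0 <= M by rewrite mulr_ge0 ?sqr_ge0 // ltW.
have e2 (a : 'M[R]_(m, d)) : 0 <= eta ^+ 2 * norm (dev a) ^+ 2.
  by rewrite mulr_ge0 // sqr_ge0.
have {budget} := budget h0 qh th_itv M0 (sqr_ge0 _) (sqr_ge0 _) (sqr_ge0 _)
  (e2 s) (sqr_ge0 _) (e2 sh) (sqr_ge0 _) (e2 s0) (e2 s1) SE
  (le_trans zhd (dz'B s)).
have scale_q (a b : 'M[R]_(m, d)) : norm (dev a) ^+ 2 <= q * norm (dev b) ^+ 2 ->
    eta ^+ 2 * norm (dev a) ^+ 2 <= q * (eta ^+ 2 * norm (dev b) ^+ 2).
  by move=> ab; rewrite (mulrCA q) ler_pM2l.
move=> /(_ (le_trans (scale_q _ _ shd) (sB _ _ vhL))).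
move=> /(_ (le_trans zpd (dz'B sh))).
have s0d' : eta ^+ 2 * norm (dev s0) ^+ 2 <= q * (eta ^+ 2 * norm (dev s) ^+ 2).
  by move: s0d; rewrite addrK; exact: scale_q.
move=> /(_ s0d').
have zp_w' : norm (vp - v) ^+ 2 <=
    L ^+ 2 * (2 * (p / 18 * S + M) + 2 * (norm (dev zp) ^+ 2 + norm (dev w) ^+ 2)).
  by apply: (le_trans vpL); rewrite ler_wpM2l ?sqr_ge0.
move=> /(_ (le_trans (scale_q _ _ s1d) (sB _ _ zp_w'))).
have im0 : 0 < m%:R^-1 :> R by rewrite invr_gt0.
move=> /(ler_wpM2l (ltW im0)) budget.
have vhN2 : eta ^+ 2 * norm (row_mean vh - row_mean v) ^+ 2
    <= m%:R^-1 * (p / 18 * S) by rewrite ler_pdivlMl.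
exact: lyapunov_average id_zp vhN2 budget.
Qed.

(** The consensus error of the query points perturbs the averaged operator; by
    Young's inequality half of the strong monotonicity absorbs this. *)
Lemma perturbed_monotone (g gbar u : 'rV[R]_d) (zh : 'M[R]_(m, d)) :
  mu * norm u ^+ 2 <= dotv g u ->
  norm (gbar - g) ^+ 2 <= m%:R^-1 * (L ^+ 2 * norm (dev zh) ^+ 2) ->
  eta * mu * norm u ^+ 2 - m%:R^-1 * (eta * (L ^+ 2 / mu) * norm (dev zh) ^+ 2)
  <= 2 * eta * dotv gbar u.
Proof.
move=> mono gerr.
have young := dotv_young (gbar - g) u mu0.
have mu_inv : 0 <= mu^-1 by rewrite invr_ge0 ltW.
have := le_trans young (lerD (ler_wpM2l mu_inv gerr) (lexx _)).
rewrite dotvBl => young'.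
exact: perturbed_monotone_arith (ltW eta0) mono young'.
Qed.

(** The distances of [z] and [w] to the saddle point are at most those of the
    query point plus the lengths of the half steps; the negative terms
    contain enough of each. *)
Lemma lyapunov_contraction (zs : 'rV[R]_d) (z w s zh : 'M[R]_(m, d)) (Gu : R) :
  let M := m%:R * norm (row_mean zh - row_mean w) ^+ 2 in
  eta * mu * norm (row_mean zh - zs) ^+ 2
    - m%:R^-1 * (eta * (L ^+ 2 / mu) * norm (dev zh) ^+ 2) <= Gu ->
  (1 - p) * norm (row_mean z - zs) ^+ 2 + norm (row_mean w - zs) ^+ 2
     - (1 - p) * norm (row_mean zh - row_mean z) ^+ 2
     - p * norm (row_mean zh - row_mean w) ^+ 2
     + m%:R^-1 * ((1 - th) * consensus_error z w s + p / 6 * M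
                  - eta * (L ^+ 2 / mu) * norm (dev zh) ^+ 2)
     - Gu
  <= (1 - th) * lyapunov zs z w s.
Proof.
move=> M hG; rewrite /lyapunov.
have split_at (a : 'rV[R]_d) : norm (a - zs) ^+ 2 <=
    2 * (norm (row_mean zh - zs) ^+ 2 + norm (row_mean zh - a) ^+ 2).
  have -> : a - zs = (row_mean zh - zs) - (row_mean zh - a).
    by rewrite opprB [RHS]addrC subrKA.
  exact: sqnormB_le.
have m_unit : m%:R^-1 * m%:R = 1 :> R by rewrite mulVf // pnatr_eq0 -lt0n.
exact: lyapunov_contraction_arith m_unit p_itv th_itv th_mu (sqr_ge0 _)
  (sqr_ge0 _) (sqr_ge0 _) (split_at _) (split_at _) hG.
Qed.

End LyapunovStep.
(** * Expectations over independent draws *)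

Section IndependentDraws.
Variables (R : realType) (I : finType) (S : Type).
Variables (pr : I -> R) (step : S -> I -> S).

(** The function [expect] for a functional of the final state, with the initial
    state as a parameter of the induction. *)
Definition path_expect T (Q : S -> R) (st : S) : R :=
  \sum_(omega : T.-tuple I) (\prod_(x <- omega) pr x) * Q (foldl step st omega).

Lemma path_expect0 Q st : path_expect 0 Q st = Q st.
Proof.
rewrite /path_expect (bigD1 [tuple]) //= [X in _ + X]big1 ?addr0 => [|omega].
  by rewrite /= big_nil mul1r.
by rewrite (tuple0 omega) => /negP[]; exact/eqP/val_inj.
Qed.

Lemma path_expectS T Q st :
  path_expect T.+1 Q st = \sum_x pr x * path_expect T Q (step st x).
Proof.
rewrite /path_expect.
pose h (q : I * T.-tuple I) := [tuple of q.1 :: q.2].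
pose h' (omega : T.+1.-tuple I) := (thead omega, [tuple of behead omega]).
have hK : cancel h h' by move=> [x w]; congr pair; apply: val_inj.
have hK' : cancel h' h by move=> w; rewrite [w in RHS]tuple_eta; apply: val_inj.
rewrite (reindex h) /=; last by exists h' => ? _; [exact: hK | exact: hK'].
under [RHS]eq_bigr do rewrite mulr_sumr.
rewrite pair_bigA; apply: eq_bigr => -[x w] _ /=.
by rewrite big_cons mulrA.
Qed.

Hypothesis pr_ge0 : forall x, 0 <= pr x.

Lemma path_expect_contraction (inv : S -> Prop) (V : S -> R) c T st :
  0 <= c -> (forall st x, inv st -> inv (step st x)) ->
  (forall st, inv st -> \sum_x pr x * V (step st x) <= c * V st) ->
  inv st -> path_expect T V st <= c ^+ T * V st.
Proof.
move=> c0 inv_step contr; elim: T st => [|T IH] st ist.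
  by rewrite path_expect0 expr0 mul1r.
rewrite path_expectS.
apply: (@le_trans _ _ (\sum_x pr x * (c ^+ T * V (step st x)))).
  by apply: ler_sum => x _; rewrite ler_wpM2l // IH //; exact: inv_step.
under eq_bigr do rewrite mulrCA.
rewrite -mulr_sumr exprSr -mulrA ler_wpM2l ?exprn_ge0 //; exact: contr.
Qed.

Lemma path_expect_le T (Q Q' : S -> R) st : (forall st, Q st <= Q' st) ->
  path_expect T Q st <= path_expect T Q' st.
Proof.
move=> QQ'; apply: ler_sum => w _; rewrite ler_wpM2l //.
by apply: prodr_ge0.
Qed.

Lemma path_expect_additive (F : S -> R) a T st :
  \sum_x pr x = 1 ->
  (forall st, \sum_x pr x * F (step st x) = F st + a) ->
  path_expect T F st = F st + T%:R * a.
Proof.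
move=> pr1 Fstep; elim: T st => [|T IH] st.
  by rewrite path_expect0 mul0r addr0.
rewrite path_expectS; under eq_bigr do rewrite IH mulrDr.
by rewrite big_split /= Fstep -mulr_suml pr1 -natr1; ring.
Qed.

End IndependentDraws.

Section Draws.
Variables (R : realType) (m n : nat).
Hypothesis n0 : (0 < n)%N.
Notation p := (p_coin R n).

Lemma p_coin_gt0 : 0 < p.
Proof. by rewrite divr_gt0 // mulr_gt0 ?ltr0n. Qed.

Definition index_prob : R := \prod_(i < m) n%:R^-1.

Lemma sum_draw (Q : draw m n -> R) :
  \sum_xi draw_prob R xi * Q xi =
  \sum_(j : {ffun 'I_m -> 'I_n})
    index_prob * (p * Q (j, true) + (1 - p) * Q (j, false)).
Proof.
transitivity (\sum_j \sum_b draw_prob R (j, b) * Q (j, b)).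
  by rewrite pair_bigA; apply: eq_bigr => -[j b].
by apply: eq_bigr => j _; rewrite big_bool /draw_prob /= -!mulrA -mulrDr.
Qed.

Lemma sum_index_prob (i0 : 'I_m) (F : 'I_n -> R) :
  \sum_(j : {ffun 'I_m -> 'I_n}) index_prob * F (j i0) = n%:R^-1 * \sum_k F k.
Proof.
pose G i k := n%:R^-1 * (if i == i0 then F k else 1) : R.
transitivity (\prod_(i < m) \sum_(k < n) G i k); last first.
  rewrite (bigD1 i0) //= [X in _ * X]big1 ?mulr1 => [|i ii0].
    by rewrite /G eqxx -mulr_sumr.
  rewrite /G (negPf ii0); under eq_bigr do rewrite mulr1.
  by rewrite sumr_const card_ord -[_ *+ n]mulr_natl mulfV // pnatr_eq0 -lt0n.
rewrite bigA_distr_bigA; apply: eq_bigr => j _.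
rewrite /G big_split /=; congr (_ * _).
rewrite (bigD1 i0) //= eqxx [X in _ * X]big1 ?mulr1 // => i ii0; by rewrite (negPf ii0).
Qed.

Lemma sum_index_prob1 : \sum_(j : {ffun 'I_m -> 'I_n}) index_prob = 1.
Proof.
have -> : index_prob = \prod_(i < m) n%:R^-1 by [].
rewrite sumr_const card_ffun !card_ord prodr_const card_ord.
by rewrite -[_ *+ _]mulr_natl natrX -exprMn mulfV ?expr1n // pnatr_eq0 -lt0n.
Qed.

Lemma sum_draw_prob : \sum_(xi : draw m n) draw_prob R xi = 1.
Proof.
transitivity (\sum_(xi : draw m n) draw_prob R xi * 1).
  by apply: eq_bigr => xi _; rewrite mulr1.
rewrite sum_draw; under eq_bigr do rewrite !mulr1 addrC subrK mulr1.
exact: sum_index_prob1.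
Qed.

Lemma draw_prob_ge0 (xi : draw m n) : 0 <= draw_prob R xi.
Proof.
rewrite /draw_prob mulr_ge0 //; first by apply: prodr_ge0 => i _; rewrite invr_ge0.
case: (xi.2); first exact/ltW/p_coin_gt0.
rewrite subr_ge0 ler_pdivrMr ?mulr_gt0 ?ltr0n // mul1r.
have : 1 <= n%:R :> R by rewrite ler1n.
lra.
Qed.

End Draws.

(** * Contraction of the Lyapunov function along the algorithm *)

Section Operators.
Variables (R : realType) (m n dx dy : nat).
Variable f : 'I_m -> 'I_n -> 'rV[R]_dx -> 'rV[R]_dy -> R.
Variable L : R.
Hypotheses (m0 : (0 < m)%N) (n0 : (0 < n)%N).
Hypothesis df : forall i j, partially_derivable (f i j).
Hypothesis fL : forall i j, smooth_fun L (f i j).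

Lemma partially_derivable_local i : partially_derivable (local_fun f i).
Proof. exact: partially_derivable_mean. Qed.

Lemma partially_derivable_global : partially_derivable (global_fun f).
Proof.
by apply: partially_derivable_mean => i; exact: partially_derivable_local.
Qed.

Lemma g_localE i z : g_local f i z = n%:R^-1 *: \sum_j g_sample f i j z.
Proof. exact: gda_op_mean. Qed.

Lemma gda_op_globalE z :
  gda_op (global_fun f) z = m%:R^-1 *: \sum_i g_local f i z.
Proof. by apply: gda_op_mean => i; exact: partially_derivable_local. Qed.

Lemma g_sample_lipschitz i j z z' :
  norm (g_sample f i j z - g_sample f i j z') ^+ 2 <= L ^+ 2 * norm (z - z') ^+ 2.
Proof. exact: gda_op_lipschitz. Qed.

Lemma g_local_lipschitz i z z' :
  norm (g_local f i z - g_local f i z') ^+ 2 <= L ^+ 2 * norm (z - z') ^+ 2.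
Proof.
rewrite !g_localE; apply: (@sqnorm_mean_lipschitz _ _ _ L n (g_sample f i)) => // j.
exact: g_sample_lipschitz.
Qed.

Lemma gda_op_global_lipschitz z z' :
  norm (gda_op (global_fun f) z - gda_op (global_fun f) z') ^+ 2
  <= L ^+ 2 * norm (z - z') ^+ 2.
Proof.
rewrite !gda_op_globalE.
by apply: (@sqnorm_mean_lipschitz _ _ _ L m (g_local f)) => // i; exact: g_local_lipschitz.
Qed.

Lemma sqnorm_rows_lipschitz (A B a b : 'M[R]_(m, dx + dy)) :
  (forall i, norm (row i A - row i B) ^+ 2 <= L ^+ 2 * norm (row i a - row i b) ^+ 2) ->
  norm (A - B) ^+ 2 <= L ^+ 2 * norm (a - b) ^+ 2.
Proof.
move=> h; rewrite !sqnorm_rows mulr_sumr; apply: ler_sum => i _.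
by rewrite !raddfB; exact: h.
Qed.

Lemma g_agg_lipschitz (a b : 'M[R]_(m, dx + dy)) :
  norm (g_agg f a - g_agg f b) ^+ 2 <= L ^+ 2 * norm (a - b) ^+ 2.
Proof.
by apply: sqnorm_rows_lipschitz => i; rewrite !rowK; exact: g_local_lipschitz.
Qed.

Lemma sqnorm_mean_agg_le (zh : 'M[R]_(m, dx + dy)) :
  norm (row_mean (g_agg f zh) - gda_op (global_fun f) (row_mean zh)) ^+ 2
  <= m%:R^-1 * (L ^+ 2 * norm (dev zh) ^+ 2).
Proof.
rewrite gda_op_globalE row_meanE -scalerBr -sumrB.
apply: (le_trans (sqnorm_mean_le _ m0)).
rewrite ler_pM2l ?invr_gt0 ?ltr0n // sqnorm_rows mulr_sumr.
apply: ler_sum => i _; rewrite /dev raddfB /= row_spread rowK.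
exact: g_local_lipschitz.
Qed.

Definition vr_estimate (j : {ffun 'I_m -> 'I_n}) (w zh : 'M[R]_(m, dx + dy)) :
    'M[R]_(m, dx + dy) :=
  \matrix_(i < m) (g_local f i (row i w) + g_sample f i (j i) (row i zh)
                   - g_sample f i (j i) (row i w)).

(** The anchor [g_local f i (row i w)] cancels, and what is left is a difference
    of one smooth sample: no variance term appears. *)
Lemma vr_estimate_lipschitz j w zh :
  norm (vr_estimate j w zh - g_agg f w) ^+ 2 <= L ^+ 2 * norm (zh - w) ^+ 2.
Proof.
have cancel_anchor (a b c : 'rV[R]_(dx + dy)) : a + b - c - a = b - c.
  by rewrite (addrAC _ _ (- a)) (addrC a) addrK.
apply: sqnorm_rows_lipschitz => i; rewrite !rowK cancel_anchor.
exact: g_sample_lipschitz.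
Qed.

Lemma vr_estimate_unbiased w zh (u : 'rV[R]_(dx + dy)) :
  \sum_(j : {ffun 'I_m -> 'I_n})
    index_prob R m n * dotv (row_mean (vr_estimate j w zh)) u
  = dotv (row_mean (g_agg f zh)) u.
Proof.
have meanE (A : 'M[R]_(m, dx + dy)) :
    dotv (row_mean A) u = m%:R^-1 * \sum_i dotv (row i A) u.
  rewrite row_meanE dotvZl dotvC dotv_sumr; congr (_ * _).
  by apply: eq_bigr => i _; exact: dotvC.
under eq_bigr do rewrite meanE mulrCA mulr_sumr.
rewrite -mulr_sumr meanE exchange_big; congr (_ * _); apply: eq_bigr => i _ /=.
pose F k := dotv (g_local f i (row i w) + g_sample f i k (row i zh)
                   - g_sample f i k (row i w)) u.
transitivity (\sum_(j : {ffun 'I_m -> 'I_n}) index_prob R m n * F (j i)).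
  by apply: eq_bigr => j _; rewrite rowK.
rewrite sum_index_prob // rowK {}/F.
under eq_bigr do rewrite dotvBl dotvDl.
rewrite !big_split /= sumrN sumr_const card_ord.
have sE z : \sum_k dotv (g_sample f i k z) u = n%:R * dotv (g_local f i z) u.
  rewrite g_localE dotvZl mulrA mulfV ?pnatr_eq0 -?lt0n // mul1r.
  by rewrite [RHS]dotvC dotv_sumr; apply: eq_bigr => k _; exact: dotvC.
rewrite !sE -[dotv _ _ *+ _]mulr_natl addrAC subrr add0r mulrA mulVf ?mul1r //.
by rewrite pnatr_eq0 -lt0n.
Qed.

End Operators.

Section RunContraction.
Variables (R : realType) (m n dx dy : nat).
Variable f : 'I_m -> 'I_n -> 'rV[R]_dx -> 'rV[R]_dy -> R.
Variables (L mu eta q th : R) (W : 'M[R]_m) (K : nat) (zs : 'rV[R]_(dx + dy)).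
Hypotheses (m0 : (0 < m)%N) (n2 : (1 < n)%N).
Hypothesis df : forall i j, partially_derivable (f i j).
Hypothesis fL : forall i j, smooth_fun L (f i j).
Hypotheses (L0 : 0 < L) (mu0 : 0 < mu) (eta0 : 0 < eta).
Hypothesis scc : strongly_convex_concave mu (global_fun f).
Hypothesis sp : saddle_point setT setT (global_fun f) zs.
Hypothesis mixK : forall A : 'M[R]_(m, dx + dy), mixes q A (FastMix W A K).
Notation p := (p_coin R n).
Hypotheses (q_itv : 0 <= q <= 291^-1)
  (etaL : eta ^+ 2 * L ^+ 2 = p / 18)
  (qh : q * (eta * (L ^+ 2 / mu)) <= p / 100)
  (th_itv : 0 <= th <= p / 3) (th_mu : 4 * th <= eta * mu).

Let n0 : (0 < n)%N. Proof. exact: ltnW. Qed.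

Notation step := (@mcsvre_step R m n dx dy f setT setT W eta K).

Definition tracking (st : state R m dx dy) : Prop :=
  st_v st = g_agg f (st_w st) /\ row_mean (st_s st) = row_mean (st_v st).

Definition state_lyapunov (st : state R m dx dy) : R :=
  lyapunov p eta zs (st_z st) (st_w st) (st_s st).

Lemma product_setTT :
  product_set [set: 'rV[R]_dx] [set: 'rV[R]_dy] = [set: 'rV[R]_(dx + dy)].
Proof. by apply/seteqP; split. Qed.

Lemma mcsvre_step_tracking st xi : tracking st -> tracking (step st xi).
Proof.
case: st xi => z w v s c r [j b]; rewrite /tracking /= product_setTT.
move=> [vE sE]; split; first by case: b.
by rewrite (mixK _).1 row_meanB row_meanD sE addrAC subrr add0r.
Qed.

Lemma p_coin_le : p <= 4^-1.
Proof.
rewrite /p_coin div1r lef_pV2 ?posrE ?mulr_gt0 ?ltr0n //.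
have : 2%:R <= n%:R :> R by rewrite ler_nat.
lra.
Qed.

(** The bounds for fixed sample indices are averaged; their only random term is
    linear in the gradient estimate, which is unbiased. *)
Lemma state_lyapunov_step st : tracking st ->
  \sum_(xi : draw m n) draw_prob R xi * state_lyapunov (step st xi)
  <= (1 - th) * state_lyapunov st.
Proof.
case: st => z w v s c r [/= vE sE].
rewrite sum_draw // /state_lyapunov /= product_setTT !proj_rows_setT.
rewrite subKr; set z' := (1 - p) *: z + p *: w.
set zh := FastMix W (z' - eta *: s) K.
pose u := row_mean zh - zs.
pose vh j := vr_estimate f j w zh.
have p_itv : 0 < p <= 4^-1 by rewrite p_coin_gt0 // p_coin_le.
have key j := @lyapunov_step_fixed_samples R m (dx + dy) p eta L mu q th
  m0 p_itv mu0 eta0 q_itv etaL qh th_itv zs z w s v zh (vh j)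
  (FastMix W (s + vh j - v) K)
  (FastMix W (z' - eta *: FastMix W (s + vh j - v) K) K)
  (g_agg f (FastMix W (z' - eta *: FastMix W (s + vh j - v) K) K))
  _ _ sE (mixK _) (mixK _) (mixK _) (mixK _) (mixK _).
have vL j : norm (vh j - v) ^+ 2 <= L ^+ 2 * norm (zh - w) ^+ 2.
  by rewrite vE; exact: vr_estimate_lipschitz.
have gL a : norm (g_agg f a - v) ^+ 2 <= L ^+ 2 * norm (a - w) ^+ 2.
  by rewrite vE; exact: g_agg_lipschitz.
have ip0 : 0 <= index_prob R m n by apply: prodr_ge0 => i _; rewrite invr_ge0.
pose B := (1 - p) * norm (row_mean z - zs) ^+ 2 + norm (row_mean w - zs) ^+ 2
     - (1 - p) * norm (row_mean zh - row_mean z) ^+ 2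
     - p * norm (row_mean zh - row_mean w) ^+ 2
     + m%:R^-1 * ((1 - th) * consensus_error eta z w s
                  + p / 6 * (m%:R * norm (row_mean zh - row_mean w) ^+ 2)
                  - eta * (L ^+ 2 / mu) * norm (dev zh) ^+ 2).
apply: (@le_trans _ _ (\sum_(j : {ffun 'I_m -> 'I_n}) index_prob R m n *
                        (B - 2 * eta * dotv (row_mean (vh j)) u))).
  apply: ler_sum => j _; rewrite !proj_rows_setT; apply: (ler_wpM2l ip0).
  exact: (key j (vL j) (gL _)).
under eq_bigr do rewrite mulrBr mulrCA.
rewrite sumrB -mulr_suml sum_index_prob1 // mul1r -mulr_sumr.
rewrite vr_estimate_unbiased //.
apply: (@lyapunov_contraction R m (dx + dy) p eta L mu th) => //.
apply: perturbed_monotone => //; last exact: sqnorm_mean_agg_le.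
apply: gda_op_strongly_monotone => //; exact: partially_derivable_global.
Qed.

End RunContraction.

(** * The prescribed parameters *)

Section PrescribedParameters.
Variables (R : realType) (m n : nat) (L mu : R).
Hypotheses (m0 : (0 < m)%N) (n2 : (1 < n)%N) (mu0 : 0 < mu) (muL : mu <= L).
Notation s := (Num.sqrt (n%:R : R)).
Notation kappa := (L / mu).
Notation eta := (1 / (6 * s * L)).
Notation p := (p_coin R n).
Notation th := (1 / (6 * (n%:R + 4 * kappa * s))).

Let L0 : 0 < L. Proof. exact: lt_le_trans muL. Qed.

Let n_ge2 : 2 <= n%:R :> R. Proof. by rewrite ler_nat. Qed.

Let n_gt0 : 0 < n%:R :> R. Proof. by rewrite ltr0n; exact: ltnW. Qed.

Let s_gt0 : 0 < s. Proof. by rewrite sqrtr_gt0. Qed.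

Let ssE : s ^+ 2 = n%:R. Proof. by rewrite sqr_sqrtr // ltW. Qed.

Lemma sqrtn_ge1 : 1 <= s.
Proof. by rewrite -[leLHS]sqrtr1 ler_sqrt //; apply: le_trans n_ge2; lra. Qed.

Lemma sqrtn_le : s <= n%:R.
Proof.
apply: (@le_trans _ _ (s ^+ 2)); last by rewrite ssE.
by rewrite expr2 ler_peMr ?sqrtn_ge1 // ltW.
Qed.

Lemma kappa_ge1 : 1 <= kappa.
Proof. by rewrite ler_pdivlMr // mul1r. Qed.

Lemma eta_gt0 : 0 < eta.
Proof. by rewrite divr_gt0 // !mulr_gt0. Qed.

Lemma sqr_etaL : eta ^+ 2 * L ^+ 2 = p / 18.
Proof.
transitivity (1 / (36 * s ^+ 2)).
  by field; rewrite gt_eqF //= gt_eqF.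
by rewrite ssE /p_coin; field; rewrite gt_eqF.
Qed.

Lemma etaL2mu : eta * (L ^+ 2 / mu) = kappa / (6 * s).
Proof. by field; rewrite !gt_eqF //. Qed.

(** The number inside the first square root in the definition of [K]. *)
Lemma mixing_target :
  12 * m%:R * n%:R * (3 / p)
    * (8 * L * eta * (2 * kappa + 3 * L * eta) / m%:R)
  = 192 * kappa * n%:R * s + 48 * n%:R.
Proof.
have m0' : m%:R != 0 :> R by rewrite pnatr_eq0 -lt0n.
have := s_gt0; rewrite /p_coin; have nE := esym ssE; set t := s in nE * => t0.
by rewrite nE; field; rewrite m0' !gt_eqF.
Qed.

Lemma mixing_small q : 0 <= q ->
  q * (192 * kappa * n%:R * s + 48 * n%:R) <= 1 ->
  q * (eta * (L ^+ 2 / mu)) <= p / 100.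
Proof.
move=> q0 hq; rewrite etaL2mu.
have k1 := kappa_ge1; have s1 := sqrtn_ge1; have n2' := n_ge2.
have qk : 0 <= q * kappa by rewrite mulr_ge0 // ltW // (lt_le_trans _ k1).
have h1 : q * kappa * (192 * n%:R * s) <= 1.
  apply: le_trans hq; rewrite -subr_ge0.
  have -> : q * (192 * kappa * n%:R * s + 48 * n%:R)
     - q * kappa * (192 * n%:R * s) = q * (48 * n%:R) by ring.
  by rewrite mulr_ge0 // mulr_ge0 // ltW.
have D0 : 0 < 6 * s by rewrite mulr_gt0.
rewrite mulrA ler_pdivrMr //.
have c0 : 0 < 192 * n%:R * s by rewrite !mulr_gt0.
rewrite -(ler_pM2r c0); apply: (le_trans h1).
have -> : p / 100 * (6 * s) * (192 * n%:R * s) = 1152 / 200 * s ^+ 2.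
  by rewrite /p_coin; field; rewrite gt_eqF.
rewrite ssE; lra.
Qed.

Lemma rate_itv : 0 <= th <= p / 3.
Proof.
have k1 := kappa_ge1; have s1 := sqrtn_ge1.
have ks : 0 <= kappa * s by rewrite mulr_ge0 ?(ltW s_gt0) // (le_trans _ k1).
have D0 : 0 < 6 * (n%:R + 4 * kappa * s).
  by rewrite mulr_gt0 // ltr_pwDl // -mulrA mulr_ge0.
apply/andP; split; first by rewrite divr_ge0 // ltW.
have -> : p / 3 = 1 / (6 * n%:R) by rewrite /p_coin; field; rewrite gt_eqF.
rewrite !div1r lef_pV2 ?posrE //; last by rewrite mulr_gt0.
rewrite ler_pM2l //.
by rewrite lerDl -mulrA mulr_ge0.
Qed.

Lemma rate_mu : 4 * th <= eta * mu.
Proof.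
have k1 := kappa_ge1; have s1 := sqrtn_ge1.
have ks : 0 < kappa * s by rewrite mulr_gt0 // (lt_le_trans _ k1).
have -> : eta * mu = 4 * (1 / (24 * (kappa * s))).
  by field; rewrite !gt_eqF.
have ng := n_gt0; move: ks; rewrite -(mulrA 4); set x := kappa * s => ks.
by rewrite ler_pM2l // !div1r lef_pV2 ?posrE; lra.
Qed.

End PrescribedParameters.

(** * Convergence after the prescribed number of iterations *)

Section Convergence.
Variables (R : realType) (m n dx dy : nat).
Variable f : 'I_m -> 'I_n -> 'rV[R]_dx -> 'rV[R]_dy -> R.
Variables (L mu eps : R) (W : 'M[R]_m) (e : rel 'I_m).
Variables (zs z0 : 'rV[R]_(dx + dy)) (K K0 T : nat).
Hypotheses (m0 : (0 < m)%N) (n2 : (1 < n)%N) (dx0 : (0 < dx)%N).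
Hypothesis df : forall i j, partially_derivable (f i j).
Hypothesis fL : forall i j, smooth_fun L (f i j).
Hypotheses (L0 : 0 < L) (mu0 : 0 < mu) (eps0 : 0 < eps).
Hypothesis scc : strongly_convex_concave mu (global_fun f).
Hypothesis sp : saddle_point setT setT (global_fun f) zs.
Hypothesis gW : gossip_matrix e W.
Notation s := (Num.sqrt (n%:R : R)).
Notation kappa := (L / mu).
Notation eta := (1 / (6 * s * L)).
Notation p := (p_coin R n).
Notation th := (1 / (6 * (n%:R + 4 * kappa * s))).
Let g0 := g_agg f (spread m z0).
Let dissim := norm (dev g0).
Let dist := norm (z0 - zs).
Let a := 10 * kappa / (3 * m%:R * s * L ^+ 2 * eps).
Let Y := 192 * kappa * n%:R * s + 48 * n%:R.

Lemma mu_le_smoothness : mu <= L.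
Proof.
apply: (mu_le_L dx0 L0 mu0 (partially_derivable_global df) scc).
by apply: gda_op_global_lipschitz => //; exact: ltnW.
Qed.

Let muL := mu_le_smoothness.

Let s0 : 0 < s. Proof. by rewrite sqrtr_gt0 ltr0n ltnW. Qed.

Let n0 : 0 < n%:R :> R. Proof. by rewrite ltr0n ltnW. Qed.

Let kappa0 : 0 < kappa. Proof. exact: divr_gt0. Qed.

Lemma mixing_rate_bounds :
  Num.sqrt (chi W) * ln (Num.max (Num.sqrt Y) (Num.sqrt 291)) <= K%:R ->
  let q := ((1 - Num.sqrt (1 - lambda2 W)) ^+ K) ^+ 2 in
  [/\ 0 <= (1 - Num.sqrt (1 - lambda2 W)) ^+ K, 0 <= q <= 291^-1 & q * Y <= 1].
Proof.
set M := Num.max _ _ => hK.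
have Y0 : 0 <= Y.
  have k0 := ltW kappa0; have s0' := ltW s0.
  by rewrite addr_ge0 ?(mulr_ge0 (mulr_ge0 (mulr_ge0 _ k0) _) s0') ?mulr_ge0 ?ler0n.
have M0 : 0 < M by rewrite lt_max orbC sqrtr_gt0 ltr0n.
have sqM x : 0 <= x -> Num.sqrt x <= M -> x <= M ^+ 2.
  move=> x0 xM; rewrite -(sqr_sqrtr x0) lerXn2r ?nnegrE ?sqrtr_ge0 //.
  exact: ltW.
have M291 : 291 <= M ^+ 2 by apply: (sqM _ (ler0n _ _)); rewrite le_max lexx orbT.
have MY : Y <= M ^+ 2 by rewrite sqM // le_max lexx.
have /andP[r0 rM] := mixing_rate_le m0 gW M0 hK.
set r := (1 - _) ^+ K in r0 rM *.
have qM : r ^+ 2 <= (M ^+ 2)^-1.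
  by rewrite -exprVn lerXn2r ?nnegrE // ltW ?invr_gt0.
have M2 : 0 < M ^+ 2 by rewrite exprn_gt0.
split=> //.
  by rewrite sqr_ge0 (le_trans qM) ?lef_pV2 ?posrE ?ltr0n.
apply: (le_trans (ler_wpM2l (sqr_ge0 _) MY)).
by rewrite -ler_pdivlMr // div1r.
Qed.

(** The prescription gives the rate at most [1 / (a * dissim ^+ 2)]; since the
    rate is at most 1, its square satisfies the same bound, and [dissim ^+ 2]
    cancels. *)
Lemma initial_tracking_error :
  Num.sqrt (chi W) * ln (a * dissim ^+ 2) <= K0%:R ->
  fastmix_estimate (dx + dy) W K0 ->
  norm (dev (FastMix W g0 K0)) ^+ 2 <= a^-1.
Proof.
move=> hK0 est0.
have a0 : 0 < a.
  apply: divr_gt0; first exact: mulr_gt0.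
  by rewrite !mulr_gt0 ?exprn_gt0 ?ltr0n.
have /andP[l0 l1] := lambda2_itv m0 gW.
have x0 := sqrtr_ge0 (1 - lambda2 W).
have x1 : Num.sqrt (1 - lambda2 W) <= 1.
  by rewrite -[leRHS]sqrtr1 ler_sqrt //; lra.
pose b := 1 - Num.sqrt (1 - lambda2 W).
have b01 : 0 <= b <= 1 by rewrite /b; lra.
have /andP[b0 b1] := b01.
have r0 : 0 <= b ^+ K0 by rewrite exprn_ge0.
have r1 : b ^+ K0 <= 1 by rewrite exprn_ile1.
have [_ le_dev] := fastmix_mixes g0 r0 est0.
apply: (le_trans le_dev).
have [d0|d0] := eqVneq dissim 0.
  by rewrite -/dissim d0 expr0n mulr0 invr_ge0 ltW.
have M0 : 0 < a * dissim ^+ 2.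
  by rewrite mulr_gt0 // lt0r sqrf_eq0 d0 sqr_ge0.
have /andP[_ rM] := mixing_rate_le m0 gW M0 hK0.
have d2 : 0 < dissim ^+ 2 by rewrite lt0r sqrf_eq0 d0 sqr_ge0.
rewrite -/dissim -ler_pdivlMr // -invfM.
by apply: le_trans rM; rewrite expr2 ler_piMr.
Qed.

Lemma rate_power :
  6 * (n%:R + 4 * kappa * s) * ln ((6 * dist ^+ 2 + eps) / eps) <= T%:R ->
  (1 - th) ^+ T * (6 * dist ^+ 2 + eps) <= eps.
Proof.
set B := 6 * dist ^+ 2 + eps => hT.
have D0 : 0 < 6 * (n%:R + 4 * kappa * s).
  by rewrite mulr_gt0 // addr_gt0 // (mulr_gt0 (mulr_gt0 _ kappa0) s0).
have B0 : 0 < B by rewrite ltr_wpDl // mulr_ge0 // sqr_ge0.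
have /andP[th0 th1] := rate_itv n2 mu0 muL.
have p1 := p_coin_le R n2.
rewrite -ler_pdivlMr //.
apply: (@le_trans _ _ (expR (- th) ^+ T)).
  rewrite lerXn2r ?nnegrE ?expR_ge0 //; last exact: expR_ge1Dx.
  rewrite subr_ge0; lra.
have Be : 0 < B / eps by rewrite divr_gt0.
rewrite -expRM_natl -[leRHS]lnK ?posrE ?divr_gt0 // ler_expR.
rewrite -[eps / B]invf_div lnV ?posrE // mulrN lerN2 div1r.
by rewrite ler_pdivlMr // mulrC.
Qed.

Lemma mcsvre_converges :
  Num.sqrt (chi W) * ln (Num.max (Num.sqrt Y) (Num.sqrt 291)) <= K%:R ->
  Num.sqrt (chi W) * ln (a * dissim ^+ 2) <= K0%:R ->
  6 * (n%:R + 4 * kappa * s) * ln ((6 * dist ^+ 2 + eps) / eps) <= T%:R ->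
  fastmix_estimate (dx + dy) W K -> fastmix_estimate (dx + dy) W K0 ->
  expect (fun omega : T.-tuple (draw m n) =>
    norm (row_mean (st_z (mcsvre f setT setT W eta K K0 z0 omega)) - zs) ^+ 2)
  <= eps.
Proof.
move=> hK hK0 hT estK estK0.
have [r0 q_itv qY] := mixing_rate_bounds hK.
set q := (_ ^+ K) ^+ 2 in q_itv qY.
have mixK (A : 'M[R]_(m, dx + dy)) : mixes q A (FastMix W A K).
  exact: fastmix_mixes.
have q0 : 0 <= q by case/andP: q_itv.
have qh := mixing_small n2 mu0 muL q0 qY.
have etaL := sqr_etaL n2 mu0 muL.
have eta0 := eta_gt0 n2 mu0 muL.
have th_itv := rate_itv n2 mu0 muL.
have th_mu := rate_mu n2 mu0 muL.
have p0 : 0 < p := p_coin_gt0 R (ltnW n2).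
have p1 := p_coin_le R n2.
pose st0 := mcsvre_init f W K0 z0.
pose V := @state_lyapunov R m n dx dy eta zs.
have track0 : tracking f st0 by split=> //=; have [] := estK0 g0.
have th1 : 0 <= 1 - th by case/andP: th_itv => _ h; rewrite subr_ge0; lra.
have contr : path_expect (@draw_prob R m n)
    (@mcsvre_step R m n dx dy f setT setT W eta K) T V st0
    <= (1 - th) ^+ T * V st0.
  apply: (@path_expect_contraction _ _ _ _ _ _ (tracking f)) => //.
  - exact/draw_prob_ge0/ltnW.
  - by move=> st xi; exact: (mcsvre_step_tracking eta mixK).
  - move=> st; exact: (state_lyapunov_step m0 n2 df fL mu0 eta0 scc sp mixK
      q_itv etaL qh th_itv th_mu).
have zV (st : state R m dx dy) :
    norm (row_mean (st_z st) - zs) ^+ 2 <= (1 - p)^-1 * V st.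
  rewrite ler_pdivlMl; last by rewrite subr_gt0; lra.
  rewrite /V /state_lyapunov /lyapunov -addrA lerDl addr_ge0 ?sqr_ge0 //.
  rewrite mulr_ge0 ?invr_ge0 // /consensus_error.
  by rewrite !addr_ge0 ?sqr_ge0 // mulr_ge0 ?sqr_ge0.
(* all agents start at the same point, so that the tracking error is the only
   initial consensus error *)
have V0 : V st0 <= 2 * dist ^+ 2 + eps / 120.
  rewrite /V /state_lyapunov /lyapunov /= /consensus_error.
  rewrite row_mean_spread // dev_spread // sqnorm0 !add0r -/dist.
  have := initial_tracking_error hK0 estK0.
  have ea : 0 <= m%:R^-1 * eta ^+ 2 by rewrite mulr_ge0 ?invr_ge0 ?sqr_ge0.
  move=> /(ler_wpM2l ea); rewrite -mulrA => h.
  have hd : (1 - p) * dist ^+ 2 <= 1 * dist ^+ 2.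
    by rewrite ler_wpM2r ?sqr_ge0 //; lra.
  have ha : m%:R^-1 * eta ^+ 2 * a^-1 <= eps / 120.
    have -> : m%:R^-1 * eta ^+ 2 * a^-1 = eps / 120 * (kappa * s)^-1.
      rewrite /a; field.
      by rewrite !gt_eqF // ltr0n.
    apply: ler_piMr; first by rewrite divr_ge0 // ltW.
    rewrite invf_le1; last exact: mulr_gt0.
    by rewrite mulr_ege1 ?kappa_ge1 ?sqrtn_ge1.
  lra.
have -> : expect (fun omega : T.-tuple (draw m n) =>
    norm (row_mean (st_z (mcsvre f setT setT W eta K K0 z0 omega)) - zs) ^+ 2)
  = path_expect (@draw_prob R m n)
      (@mcsvre_step R m n dx dy f setT setT W eta K) T
      (fun st => norm (row_mean (st_z st) - zs) ^+ 2) st0 by [].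
apply: (le_trans (path_expect_le _ (@draw_prob_ge0 R m n (ltnW n2)) _ _ zV)).
have -> : path_expect (@draw_prob R m n)
      (@mcsvre_step R m n dx dy f setT setT W eta K) T
      (fun st => (1 - p)^-1 * V st) st0 =
    (1 - p)^-1 * path_expect (@draw_prob R m n)
      (@mcsvre_step R m n dx dy f setT setT W eta K) T V st0.
  by rewrite mulr_sumr; apply: eq_bigr => w _; exact: mulrCA.
have p4 : (1 - p)^-1 <= 4 / 3.
  by rewrite invf_ple ?posrE //; lra.
have pi0 : 0 <= (1 - p)^-1 by rewrite invr_ge0; lra.
apply: (le_trans (ler_wpM2l pi0 contr)).
apply: le_trans (rate_power hT).
rewrite mulrCA ler_wpM2l ?exprn_ge0 //.
have B0 : 0 <= 2 * dist ^+ 2 + eps / 120.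
  rewrite addr_ge0 //; first by rewrite mulr_ge0 ?sqr_ge0.
  by rewrite divr_ge0 // ltW.
apply: (le_trans (ler_wpM2l pi0 V0)); apply: (le_trans (ler_wpM2r B0 p4)).
have := sqr_ge0 dist; have := ltW eps0; lra.
Qed.

End Convergence.

(** * Cost of the run *)

Section Cost.
Variables (R : realType) (m n dx dy : nat).
Variable f : 'I_m -> 'I_n -> 'rV[R]_dx -> 'rV[R]_dy -> R.
Variables (X : set 'rV[R]_dx) (Y : set 'rV[R]_dy) (W : 'M[R]_m) (eta : R).
Variables (K K0 : nat) (z0 : 'rV[R]_(dx + dy)).

Lemma mcsvre_rounds T (omega : T.-tuple (draw m n)) :
  st_rounds (mcsvre f X Y W eta K K0 z0 omega) = (K0 + T * (K + K + K + K))%N.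
Proof.
rewrite /mcsvre -[in RHS](size_tuple omega).
have -> : K0 = st_rounds (mcsvre_init f W K0 z0) by [].
move: (mcsvre_init _ _ _ _) => st.
elim: (tval omega) st => [|xi w IH] st /=; first by rewrite addn0.
rewrite IH; case: st => z v w' s c r /=.
by rewrite mulSn [RHS]addnA.
Qed.

(** Refreshing the reference point costs [n] calls with probability
    [1 / (2 * n)], hence one half in expectation. *)
Lemma mcsvre_expected_sfo T (i : 'I_m) : (0 < n)%N ->
  expect (fun omega : T.-tuple (draw m n) =>
    (st_sfo (mcsvre f X Y W eta K K0 z0 omega) i)%:R)
  = n%:R + T%:R * (5 / 2) :> R.
Proof.
move=> n0; have n0' : n%:R != 0 :> R by rewrite pnatr_eq0 -lt0n.
apply: (@path_expect_additive _ _ _ (@draw_prob R m n)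
  (@mcsvre_step R m n dx dy f X Y W eta K) (fun st => (st_sfo st i)%:R) (5 / 2) T
  (mcsvre_init f W K0 z0)); first exact: sum_draw_prob.
move=> [z w v s c r]; rewrite sum_draw //= -mulr_suml sum_index_prob1 // mul1r.
by rewrite !natrD /p_coin; field.
Qed.

End Cost.

Section CostBounds.
Variable R : realType.
Implicit Types x y : R.

Lemma ln_le_add x B y : 1 <= B -> 1 <= y -> x <= B * y -> ln x <= ln B + ln y.
Proof.
move=> B1 y1 xBy; have B0 : 0 < B by lra.
have y0 : 0 < y by lra.
(* [ln] is 0 on the nonpositive numbers *)
have [x0|x0] := leP x 0; first by rewrite ln0 // addr_ge0 // ln_ge0.
by rewrite -lnM ?posrE // ler_ln ?posrE // mulr_gt0.
Qed.

Variables (L D G eps0 : R).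
Hypotheses (L0 : 0 < L) (e0 : 0 < eps0 < 1).

(** In the three constants that follow, a reciprocal of [ln (1 / eps0)] or
    [ln 2] turns a term without the factor [ln (1 / eps)] or
    [ln (kappa * n)] into a multiple of that factor; the last summand of each
    accounts for the rounding up. *)
Definition iter_const : R :=
  24 * (ln (6 * D ^+ 2 + 1) / ln (1 / eps0) + 1) + (ln (1 / eps0))^-1.

Definition mix_const : R := ln 18 / ln 2 + 1 + (ln 2)^-1.

Definition init_const : R :=
  ln (10 * G ^+ 2 / (3 * L ^+ 2) + 1) / (ln 2 * ln (1 / eps0))
  + (ln (1 / eps0))^-1 + (ln 2)^-1 + (ln 2 * ln (1 / eps0))^-1.

Definition cost_const : R :=
  (ln (1 / eps0))^-1 + 5 / 2 * iter_const + (init_const + 4 * mix_const * iter_const).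

Lemma ln_inv_eps0 : 0 < ln (1 / eps0).
Proof. by case/andP: e0 => a b; rewrite ln_gt0 // ltr_pdivlMr // mul1r. Qed.

Lemma ln2_gt0 : 0 < ln 2 :> R.
Proof. by rewrite ln_gt0 // ltr1n. Qed.

Lemma iter_const_ge0 : 0 <= iter_const.
Proof.
have l0 := ln_inv_eps0.
have : 0 <= ln (6 * D ^+ 2 + 1) by rewrite ln_ge0 // lerDr mulr_ge0 ?sqr_ge0.
by move=> ?; rewrite addr_ge0 ?invr_ge0 ?mulr_ge0 ?addr_ge0 ?divr_ge0 // ltW.
Qed.

Lemma mix_const_ge0 : 0 <= mix_const.
Proof.
have l0 := ltW ln2_gt0.
have l18 : 0 <= ln 18 :> R by rewrite ln_ge0 // ler1n.
by rewrite addr_ge0 ?invr_ge0 // addr_ge0 // divr_ge0.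
Qed.

Lemma init_const_ge0 : 0 <= init_const.
Proof.
have l0 := ltW ln2_gt0; have le := ltW ln_inv_eps0.
have lB : 0 <= ln (10 * G ^+ 2 / (3 * L ^+ 2) + 1).
  by rewrite ln_ge0 // lerDr divr_ge0 // mulr_ge0 // sqr_ge0.
by rewrite !addr_ge0 ?invr_ge0 ?divr_ge0 // mulr_ge0.
Qed.

Lemma cost_const_gt0 : 0 < cost_const.
Proof.
have i0 := iter_const_ge0; have k0 := mix_const_ge0; have j0 := init_const_ge0.
have l0 : 0 < (ln (1 / eps0))^-1 by rewrite invr_gt0 ln_inv_eps0.
have c1 : 0 <= 5 / 2 * iter_const by apply: mulr_ge0 => //; exact: divr_ge0.
have c2 : 0 <= 4 * mix_const * iter_const.
  by apply: mulr_ge0 => //; exact: mulr_ge0.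
rewrite /cost_const -addrA; apply: ltr_pwDl => //.
by apply: addr_ge0 => //; exact: addr_ge0.
Qed.

Section Bounds.
Variables (m n : nat) (kappa x eps dist dissim : R) (T K K0 : nat).
Hypotheses (m0 : (0 < m)%N) (n2 : (1 < n)%N) (k1 : 1 <= kappa) (x1 : 1 <= x).
Hypotheses (eps_gt0 : 0 < eps) (eps_le : eps <= eps0).
Hypotheses (dist_ge0 : 0 <= dist) (distD : dist <= D).
Hypotheses (dissim_ge0 : 0 <= dissim) (dissimG : dissim <= G).
Notation s := (Num.sqrt (n%:R : R)).
Notation l := (ln (1 / eps)).
Notation Q := (n%:R + kappa * s).

Let s1 : 1 <= s. Proof. exact: sqrtn_ge1. Qed.

Let l_le : ln (1 / eps0) <= l.
Proof.
have /andP[a b] := e0.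
by rewrite ler_ln ?posrE ?divr_gt0 // !div1r lef_pV2 ?posrE.
Qed.

Let l_gt0 : 0 < l. Proof. exact: lt_le_trans ln_inv_eps0 l_le. Qed.

Let eps1 : eps <= 1.
Proof. by have /andP[_ /ltW h] := e0; exact: le_trans eps_le h. Qed.

Let one_le_l : 1 <= (ln (1 / eps0))^-1 * l.
Proof. by rewrite ler_pdivlMl ?mulr1 // ln_inv_eps0. Qed.

Let nQ : n%:R <= Q.
Proof. by rewrite lerDl mulr_ge0 // (le_trans _ k1, le_trans _ s1). Qed.

Let Q1 : 1 <= Q.
Proof. by apply: le_trans nQ; rewrite ler1n ltnW. Qed.

Let Q0 : 0 <= Q. Proof. exact: le_trans ler01 Q1. Qed.

Lemma iterations_bound :
  T = nat_ceil (6 * (n%:R + 4 * kappa * s) * ln ((6 * dist ^+ 2 + eps) / eps)) ->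
  T%:R <= iter_const * (Q * l).
Proof.
move=> ->; apply: (le_trans (nat_ceil_le _)).
set A := ln (6 * D ^+ 2 + 1).
have A0 : 0 <= A by rewrite ln_ge0 // lerDr mulr_ge0 ?sqr_ge0.
have i0 := ln_inv_eps0; have /andP[ea eb] := e0.
have hln : ln ((6 * dist ^+ 2 + eps) / eps) <= A + l.
  apply: ln_le_add.
  - by rewrite lerDr mulr_ge0 ?sqr_ge0.
  - by rewrite ler_pdivlMr // mul1r.
  - rewrite div1r; apply: ler_wpM2r; first by rewrite invr_ge0 ltW.
    apply: lerD => //; rewrite ler_wpM2l // lerXn2r ?nnegrE //.
    exact: le_trans distD.
have hln' : A + l <= (A / ln (1 / eps0) + 1) * l.
  rewrite mulrDl [1 * l]mul1r lerD2r -[leLHS]mulr1 -mulrA ler_wpM2l //.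
have P0 : 0 <= 6 * (n%:R + 4 * kappa * s).
  by rewrite mulr_ge0 // addr_ge0 // !mulr_ge0 // (le_trans _ k1, le_trans _ s1).
have PQ : 6 * (n%:R + 4 * kappa * s) <= 24 * Q.
  have : 0 <= n%:R :> R by [].
  lra.
have c0 : 0 <= (A / ln (1 / eps0) + 1) * l.
  by rewrite mulr_ge0 ?addr_ge0 ?divr_ge0 // ltW.
have h1 : 6 * (n%:R + 4 * kappa * s) * ln ((6 * dist ^+ 2 + eps) / eps)
    <= 24 * Q * ((A / ln (1 / eps0) + 1) * l).
  apply: (le_trans (ler_wpM2l P0 (le_trans hln hln'))); exact: ler_wpM2r.
have h2 : 1 <= (ln (1 / eps0))^-1 * (Q * l).
  rewrite mulrCA; apply: mulr_ege1 => //.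
have h3 : 0 <= 24 * Q * ((A / ln (1 / eps0) + 1) * l).
  by apply: mulr_ge0 => //; exact: mulr_ge0.
have -> : iter_const * (Q * l) =
    24 * Q * ((A / ln (1 / eps0) + 1) * l) + (ln (1 / eps0))^-1 * (Q * l).
  by rewrite /iter_const -/A; ring.
by rewrite lerD // ge_max h3 h1.
Qed.

Hypothesis T_le : T%:R <= iter_const * (Q * l).

Let Ql0 : 0 <= Q * l. Proof. by apply: mulr_ge0 => //; exact: ltW. Qed.

Lemma sfo_bound : n%:R + T%:R * (5 / 2) <= cost_const * (Q * l).
Proof.
have h : n%:R <= (ln (1 / eps0))^-1 * (Q * l).
  rewrite mulrCA; apply: (le_trans nQ).
  by rewrite ler_peMr.
have -> : cost_const * (Q * l) = (ln (1 / eps0))^-1 * (Q * l)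
    + iter_const * (Q * l) * (5 / 2)
    + (init_const + 4 * mix_const * iter_const) * (Q * l).
  by rewrite /cost_const; ring.
rewrite -[leLHS]addr0; apply: lerD.
  by apply: lerD => //; rewrite ler_wpM2r ?divr_ge0.
have i0 := iter_const_ge0; have k0 := mix_const_ge0; have j0 := init_const_ge0.
apply: mulr_ge0 => //; apply: addr_ge0 => //; apply: mulr_ge0 => //.
exact: mulr_ge0.
Qed.

Notation lk := (ln (kappa * n%:R)).

Let n_ge2 : 2 <= n%:R :> R. Proof. by rewrite ler_nat. Qed.

Let kn_ge2 : 2 <= kappa * n%:R.
Proof. by apply: (le_trans n_ge2); rewrite ler_peMl. Qed.

Let lk_ge : ln 2 <= lk.
Proof. by rewrite ler_ln ?posrE // ?(lt_le_trans _ kn_ge2) // ltr0n. Qed.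

Let lk_gt0 : 0 < lk. Proof. exact: lt_le_trans ln2_gt0 lk_ge. Qed.

Let kn1 : 1 <= kappa * n%:R.
Proof. by have := kn_ge2; lra. Qed.

Let kn0 : 0 <= kappa * n%:R. Proof. exact: le_trans ler01 kn1. Qed.

Let x0 : 0 <= x. Proof. exact: le_trans ler01 x1. Qed.

Lemma mixing_rounds_bound :
  K = nat_ceil (x * ln (Num.max (Num.sqrt (192 * kappa * n%:R * s + 48 * n%:R))
                                (Num.sqrt 291))) ->
  K%:R <= mix_const * (x * lk).
Proof.
move=> ->; apply: (le_trans (nat_ceil_le _)).
have sqrt_le (y z : R) : 0 <= z -> y <= z ^+ 2 -> Num.sqrt y <= z.
  by move=> z0 yz; rewrite -[leRHS]ger0_norm // -sqrtr_sqr ler_wsqrtr.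
have sn := sqrtn_le R n2.
have hM : Num.max (Num.sqrt (192 * kappa * n%:R * s + 48 * n%:R))
    (Num.sqrt 291) <= 18 * (kappa * n%:R).
  rewrite ge_max; apply/andP; split; apply: sqrt_le; try exact: mulr_ge0.
  - have h1 : kappa * n%:R * s <= (kappa * n%:R) ^+ 2.
      rewrite expr2 ler_wpM2l // (le_trans sn) // ler_peMl //.
    have h2 : n%:R <= (kappa * n%:R) ^+ 2.
      apply: (@le_trans _ _ (kappa * n%:R)); first by rewrite ler_peMl.
      by rewrite expr2 ler_peMr.
    have h3 : 0 <= (kappa * n%:R) ^+ 2 by exact: sqr_ge0.
    rewrite exprMn; move: h1 h2 h3; set z := _ ^+ 2; set y := kappa * n%:R * s.
    rewrite -!(mulrA 192) -/y; lra.
  - have h3 : 2 ^+ 2 <= (kappa * n%:R) ^+ 2 by rewrite lerXn2r ?nnegrE.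
    rewrite exprMn; move: h3; set z := (_ * _) ^+ 2; lra.
have hln := ln_le_add (_ : 1 <= 18) (_ : 1 <= kappa * n%:R) hM.
have {hln} hln : ln (Num.max (Num.sqrt (192 * kappa * n%:R * s + 48 * n%:R))
    (Num.sqrt 291)) <= ln 18 + lk by apply: hln => //; rewrite ler1n.
have h18 : ln 18 <= ln 18 / ln 2 * lk.
  rewrite -mulrA -[leLHS]mulr1 ler_wpM2l ?ln_ge0 ?ler1n //.
  by rewrite ler_pdivlMl ?ln2_gt0 // mulr1.
have h1 : 1 <= (ln 2)^-1 * (x * lk).
  rewrite mulrCA -[leLHS]mulr1; apply: ler_pM => //.
  by rewrite ler_pdivlMl ?ln2_gt0 // mulr1.
have hx : x * ln (Num.max (Num.sqrt (192 * kappa * n%:R * s + 48 * n%:R))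
    (Num.sqrt 291)) <= (ln 18 / ln 2 + 1) * (x * lk).
  rewrite mulrCA ler_wpM2l //; apply: (le_trans hln).
  by rewrite mulrDl [1 * lk]mul1r lerD2r.
have -> : mix_const * (x * lk) =
    (ln 18 / ln 2 + 1) * (x * lk) + (ln 2)^-1 * (x * lk).
  by rewrite /mix_const; ring.
apply: lerD => //.
rewrite ge_max hx andbT mulr_ge0 ?(mulr_ge0 x0) ?(ltW lk_gt0) //.
by rewrite addr_ge0 // divr_ge0 ?(ltW ln2_gt0) // ln_ge0 // ler1n.
Qed.

Lemma initial_rounds_bound :
  K0 = nat_ceil (x * ln (10 * kappa / (3 * m%:R * s * L ^+ 2 * eps)
                         * dissim ^+ 2)) ->
  K0%:R <= init_const * (x * (lk * l)).
Proof.
move=> ->; apply: (le_trans (nat_ceil_le _)).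
set B := 10 * G ^+ 2 / (3 * L ^+ 2) + 1.
have L2 : 0 < 3 * L ^+ 2 by rewrite mulr_gt0 // exprn_gt0.
have B0 : 0 <= 10 * G ^+ 2 / (3 * L ^+ 2).
  by rewrite divr_ge0 ?(ltW L2) // mulr_ge0 // sqr_ge0.
have B1 : 1 <= B by rewrite lerDr.
have /andP[ea eb] := e0.
have ieps : 1 <= 1 / eps by rewrite ler_pdivlMr // mul1r.
have hB : 10 * kappa / (3 * m%:R * s * L ^+ 2 * eps) * dissim ^+ 2
    <= B * (kappa * n%:R * (1 / eps)).
  have d2 : dissim ^+ 2 <= G ^+ 2.
    by rewrite lerXn2r ?nnegrE // (le_trans _ dissimG).
  have ms1 : 1 <= m%:R * s by rewrite mulr_ege1 // ler1n.
  have ms0 : 0 < m%:R * s by lra.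
  have -> : 10 * kappa / (3 * m%:R * s * L ^+ 2 * eps) * dissim ^+ 2
      = (kappa * (1 / eps)) * (10 * dissim ^+ 2 / (3 * L ^+ 2) / (m%:R * s)).
    by field; rewrite !gt_eqF // ?ltr0n // sqrtr_gt0 ltr0n ltnW.
  have -> : B * (kappa * n%:R * (1 / eps)) = (kappa * (1 / eps)) * (B * n%:R).
    by ring.
  have ke0 : 0 <= kappa * (1 / eps).
    exact: mulr_ge0 (le_trans ler01 k1) (le_trans ler01 ieps).
  apply: ler_wpM2l => //; rewrite ler_pdivrMr //.
  have Bge0 : 0 <= B by exact: le_trans ler01 B1.
  apply: (@le_trans _ _ B).
    rewrite /B ler_wpDr // ler_wpM2r ?invr_ge0 ?(ltW L2) //.
    by rewrite ler_wpM2l.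
  apply: (@le_trans _ _ (B * n%:R)); first by rewrite ler_peMr // ler1n ltnW.
  by rewrite ler_peMr // mulr_ge0.
have kne : 1 <= kappa * n%:R * (1 / eps) by rewrite mulr_ege1.
have := ln_le_add B1 kne hB.
have -> : ln (kappa * n%:R * (1 / eps)) = lk + l.
  by rewrite lnM ?posrE ?divr_gt0 //; exact: lt_le_trans ltr01 kn1.
set lnA := ln (_ * dissim ^+ 2) => hln.
have lB0 : 0 <= ln B by exact: ln_ge0.
have i0 := ln_inv_eps0; have i2 := ln2_gt0.
have u1 : 1 <= (ln 2)^-1 * lk by rewrite ler_pdivlMl ?mulr1.
have u2 := one_le_l.
have u3 : 1 <= (ln 2 * ln (1 / eps0))^-1 * (lk * l).
  by rewrite invfM mulrACA mulr_ege1.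
have h1 : ln B <= ln B / (ln 2 * ln (1 / eps0)) * (lk * l).
  by rewrite -mulrA ler_peMr.
have h2 : lk <= (ln (1 / eps0))^-1 * (lk * l).
  by rewrite mulrCA ler_peMr // ltW.
have h3 : l <= (ln 2)^-1 * (lk * l).
  by rewrite mulrA ler_peMl // ltW.
have h4 : 1 <= (ln 2 * ln (1 / eps0))^-1 * (x * (lk * l)).
  by rewrite mulrCA mulr_ege1.
set c' := ln B / (ln 2 * ln (1 / eps0)) + (ln (1 / eps0))^-1 + (ln 2)^-1.
have hc : lnA <= c' * (lk * l) by rewrite /c' !mulrDl; lra.
have c'0 : 0 <= c'.
  have i20 := ltW i2; have i00 := ltW i0.
  rewrite /c' !addr_ge0 ?invr_ge0 //; apply: divr_ge0 => //; exact: mulr_ge0.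
have lkl : 0 <= lk * l by rewrite mulr_ge0 // ltW.
have -> : init_const * (x * (lk * l)) =
    c' * (x * (lk * l)) + (ln 2 * ln (1 / eps0))^-1 * (x * (lk * l)).
  by rewrite -mulrDl.
apply: lerD => //.
rewrite ge_max mulr_ge0 ?(mulr_ge0 x0) //=.
by rewrite mulrCA ler_wpM2l.
Qed.

Hypothesis K_le : K%:R <= mix_const * (x * lk).
Hypothesis K0_le : K0%:R <= init_const * (x * (lk * l)).

Lemma rounds_bound :
  (K0 + T * (K + K + K + K))%:R <= cost_const * (Q * x * lk * l).
Proof.
have i0 := iter_const_ge0; have k0 := mix_const_ge0; have j0 := init_const_ge0.
have xlk : 0 <= x * lk by rewrite mulr_ge0 // ltW.
have P0 : 0 <= Q * x * lk * l.
  by rewrite -!mulrA; apply: mulr_ge0 => //; rewrite mulrA mulr_ge0 // ltW.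
have hK0 : K0%:R <= init_const * (Q * x * lk * l).
  apply: (le_trans K0_le); rewrite ler_wpM2l // -!mulrA ler_peMl //.
  by rewrite mulrA mulr_ge0 // ltW.
have hTK : T%:R * K%:R <= iter_const * (Q * l) * (mix_const * (x * lk)).
  exact: ler_pM.
have -> : (K0 + T * (K + K + K + K))%:R = K0%:R + 4 * (T%:R * K%:R) :> R.
  by rewrite natrD natrM !natrD; ring.
have -> : cost_const * (Q * x * lk * l) =
   init_const * (Q * x * lk * l)
   + 4 * (iter_const * (Q * l) * (mix_const * (x * lk)))
   + ((ln (1 / eps0))^-1 + 5 / 2 * iter_const) * (Q * x * lk * l).
  by rewrite /cost_const; ring.
rewrite -[leLHS]addr0; apply: lerD.
  by apply: lerD => //; rewrite ler_wpM2l.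
apply: mulr_ge0 => //; apply: addr_ge0.
  by rewrite invr_ge0 ltW // ln_inv_eps0.
by rewrite mulr_ge0 // divr_ge0.
Qed.

End Bounds.
End CostBounds.

(* The constant [c] hidden in the two O-bounds depends only on L, on bounds D
   and G for the initial distance and the initial gradient dissimilarity, and
   on the threshold eps0 < 1 below which log(1/eps) is bounded away from 0. *)
Theorem theorem4p1 (R : realType) (L D G eps0 : R) :
  0 < L -> 0 < eps0 < 1 ->
  exists2 c : R, 0 < c &
  forall (m n dx dy : nat)
    (X : set 'rV[R]_dx) (Y : set 'rV[R]_dy)
    (f : 'I_m -> 'I_n -> 'rV[R]_dx -> 'rV[R]_dy -> R)
    (mu : R) (zstar z0 : 'rV[R]_(dx + dy))
    (e : rel 'I_m) (W : 'M[R]_m) (eps : R),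
  (1 <= m)%N -> (2 <= n)%N -> (1 <= dx)%N -> (1 <= dy)%N ->
  X = setT -> Y = setT ->
  (forall i j x y,
     differentiable (fun u : 'rV[R]_dx * 'rV[R]_dy => f i j u.1 u.2) (x, y)) ->
  (forall i j, smooth_fun L (f i j)) ->
  0 < mu -> strongly_convex_concave mu (global_fun f) ->
  saddle_point X Y (global_fun f) zstar ->
  gossip_matrix e W ->
  product_set X Y z0 ->
  0 < eps ->
  let kappa := L / mu in
  let sqrtn := Num.sqrt n%:R in
  let eta := 1 / (6 * sqrtn * L) in
  let p := p_coin R n in
  let C := 8 * L * eta * (2 * kappa + 3 * L * eta) / m%:R in
  let c2 := 3 / p in
  let K := nat_ceil (Num.sqrt (chi W) *
    ln (Num.max (Num.sqrt (12 * m%:R * n%:R * c2 * C)) (Num.sqrt 291))) in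
  let zbar0 := row_mean (spread m z0) in
  let dist0 := norm (zbar0 - zstar) in
  let T := nat_ceil (6 * (n%:R + 4 * kappa * sqrtn) *
    ln ((6 * dist0 ^+ 2 + eps) / eps)) in
  let g0 := g_agg f (spread m z0) in
  let dissim0 := norm (g0 - spread m (row_mean g0)) in
  let K0 := nat_ceil (Num.sqrt (chi W) *
    ln (10 * kappa / (3 * m%:R * sqrtn * L ^+ 2 * eps) * dissim0 ^+ 2)) in
  let run := @mcsvre R m n dx dy f X Y W eta K K0 z0 T in
  (fastmix_estimate (dx + dy) W K -> fastmix_estimate (dx + dy) W K0 ->
   expect (fun omega => norm (row_mean (st_z (run omega)) - zstar) ^+ 2) <= eps)
  /\
  (dist0 <= D -> dissim0 <= G -> eps <= eps0 ->
   (forall i : 'I_m,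
      expect (fun omega => (st_sfo (run omega) i)%:R)
      <= c * ((n%:R + kappa * sqrtn) * ln (1 / eps)))
   /\
   (forall omega,
      (st_rounds (run omega))%:R
      <= c * ((n%:R + kappa * sqrtn) * Num.sqrt (chi W)
              * ln (kappa * n%:R) * ln (1 / eps)))).
Proof.
move=> L0 e0; exists (cost_const L D G eps0); first exact: cost_const_gt0.
move=> m n dx dy X Y f mu zstar z0 e W eps m0 n2 dx0 _ -> -> dfun fL mu0 scc sp.
move=> gW _ eps_gt0 kappa sqrtn eta p C c2 K zbar0 dist0 T g0 dissim0 K0 run.
have df i j : partially_derivable (f i j).
  by apply: differentiable_partially => x y; exact: dfun.
have muL := mu_le_smoothness m0 n2 dx0 df fL L0 mu0 scc.
have KE : K = nat_ceil (Num.sqrt (chi W) * ln (Num.max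
    (Num.sqrt (192 * kappa * n%:R * sqrtn + 48 * n%:R)) (Num.sqrt 291))).
  by rewrite /K /c2 /C -(mixing_target m0 n2 mu0 muL).
have z0E : zbar0 = z0 by exact: row_mean_spread.
split=> [estK estK0|dist_le dissim_le eps_le].
  apply: (mcsvre_converges m0 n2 dx0 df fL L0 mu0 eps_gt0 scc sp gW) => //.
  - by rewrite KE; exact: nat_ceil_ge.
  - exact: nat_ceil_ge.
  - by rewrite -z0E; exact: nat_ceil_ge.
have k1 : 1 <= kappa := kappa_ge1 mu0 muL.
have x1 : 1 <= Num.sqrt (chi W).
  by rewrite -[leLHS]sqrtr1 ler_wsqrtr // (chi_ge1 m0 gW).
have T_le := iterations_bound e0 n2 k1 eps_gt0 eps_le (norm_ge0 _) dist_le
  (erefl T).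
split=> [i|omega].
  rewrite /run mcsvre_expected_sfo; last exact: ltnW.
  exact: (sfo_bound L G e0 n2 k1 eps_gt0 eps_le T_le).
rewrite /run mcsvre_rounds.
have K_le := mixing_rounds_bound n2 k1 x1 KE.
have K0_le := initial_rounds_bound L0 e0 m0 n2 k1 x1 eps_gt0 eps_le
  (norm_ge0 _) dissim_le (erefl K0).
exact: (rounds_bound e0 n2 k1 x1 eps_gt0 eps_le T_le K_le K0_le).
Qed.
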